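(* Let $G$ be a finitely generated virtually abelian group, $\Sigma$ a finite monoid generating set of $G$, and $\|\cdot\|:\Sigma\to\mathbb Z_{>0}$ a weight function (for instance constantly $1$). There exist polyhedral geodesic systems for the partition of $G$ into singletons, for the partition of $G$ into cosets $gH$ of any given subgroup $H\le G$, and for the partition of $G$ into conjugacy classes. Fix such systems, and let $\mathrm{GF}(G)$, $\mathrm{GF}(G/H)$, $\mathrm{GF}(\mathcal C)\subseteq S^*$ be the corresponding unions $\bigcup_{\pi\in P}U^\pi$; for $V\subseteq G$ let $\mathrm{GF}(V)=\{w\in\mathrm{GF}(G):\overline w\in V\}$. Then there is an $n$, depending on $\Sigma$, such that for each of the following languages $\mathcal L\subseteq S^*$: (1) $\mathcal L=\mathrm{GF}(V)$ for $V\subseteq G$ a rational set; (2) $\mathcal L=\mathrm{GF}(V)$ for $V$ a subgroup of $G$; (3) $\mathcal L=\mathrm{GF}(G/H)$ for $H$ a subgroup of $G$; (4) $\mathcal L=\mathrm{GF}(V)$ for $V$ an algebraic set; (5) $\mathcal L=\mathrm{GF}(V)$ for $V$ a definable set; (6) $\mathcal L=\mathrm{GF}(\mathcal C)$; the following hold: (i) the set of tuples $\psi(\mathcal L)=\bigcup_{\pi\in P}\psi_\pi(\mathcal L\cap W^\pi)\subseteq (S^* )^n$ (shorter tuples being padded on the right by coordinates equal to the empty word) is an $n$-regular language; (ii) each tuple in $\psi(\mathcal L)$ corresponds, by concatenating its coordinates (and writing each letter $s\in S$ as a minimal-weight product of at most $d$ elements of $\Sigma$), to a geodesic representative of a group element;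 (iii) the projection $\theta(\psi(\mathcal L))=\mathcal L$ is an EDT0L language (over $S$ and, after writing each letter of $S$ as a word over $\Sigma$ as in (ii), over $\Sigma$), where $\theta(w_1,\dots,w_n)=w_1w_2\cdots w_n$. In (4) and (5), sets $V\subseteq G^q$ with $q\ge1$ are allowed; for these the statement is made with the finitely generated virtually abelian group $G^q$ and a finite monoid generating set of $G^q$ in place of $G$ and $\Sigma$.
   Context: $\mathbb N=\{0,1,2,\dots\}$. Fix a normal free abelian subgroup $\mathbb Z^k\le G$ of finite index $d$. The weight of a word is the sum of the weights of its letters; $\overline w\in G$ is the element represented by a word $w$; a geodesic representative of $g$ is a word of minimal weight among all words representing $g$. Rational sets. For a group $M$ with finite monoid generating set $A$, a subset $R\subseteq M$ is rational if it is the image of a regular language $L\subseteq A^*$ under the natural projection $A^*\to M$. Algebraic and definable sets. An algebraic set in $G^q$ is the set of solutions in $G^q$ of a (finite) system of equations in $q$ variables with coefficients in $G$. A set $V\subseteq G^q$ is definable if there are a first-order formula $\Phi(x_1,\dots,x_q,y_1,\dots,y_n)$ in the language of groups and parameters $m_1,\dots,m_n\in G$ such that $V=\{\overline g\in G^q:\Phi(\overline g,m_1,\dots,m_n)\text{ holds in }G\}$. Polyhedral sets. An elementary region of $\mathbb Z^r$ is a set $\{z:u\cdot z=a\}$, $\{z:u\cdot z\equiv a \bmod b\}$ or $\{z:u\cdot z>a\}$ with $u\in\mathbb Z^r$, $a\in\mathbb Z$, $b\in\mathbb N$. A polyhedral set is a finite union of finite intersections of elementary regions. Patterned words. Let $S\subseteq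 G$ be the set of elements expressible as products of at least 1 and at most $d$ elements of $\Sigma$; the weight of $s\in S$ is the minimum of $\sum\|s_i\|$ over such expressions $s=s_1\cdots s_j$, $1\le j\le d$. Let $X=S\cap\mathbb Z^k=\{x_1,\dots,x_r\}$ and $Y=S\setminus X$. A pattern is a word $\pi=\pi_1\cdots\pi_l\in Y^*$ ($\pi_i\in Y$), with length $|\pi|=l$; $P$ is the finite set of patterns of length at most $d$. Put $m_\pi=lr+r$. $W^\pi\subseteq S^*$ is the set of words $$x_1^{i_1}\cdots x_r^{i_r}\,\pi_1\,x_1^{i_{r+1}}\cdots x_r^{i_{2r}}\,\pi_2\cdots\pi_l\,x_1^{i_{lr+1}}\cdots x_r^{i_{lr+r}},\qquad i_j\in\mathbb N.$$ The bijection $\phi_\pi:W^\pi\to\mathbb N^{m_\pi}$ sends this word to $(i_1,\dots,i_{lr+r})$, and the injection $\psi_\pi:W^\pi\to(S^* )^{m_\pi+|\pi|}$ sends it to the tuple $(x_1^{i_1},\dots,x_r^{i_r},\pi_1,x_1^{i_{r+1}},\dots,x_r^{i_{2r}},\pi_2,\dots,\pi_l,x_1^{i_{lr+1}},\dots,x_r^{i_{lr+r}})$. Polyhedral geodesic system. For a partition of $G$ into classes, this is a family of sets $U^\pi\subseteq W^\pi$ ($\pi\in P$) such that: (1) for each class $C$, the disjoint union $\bigcup_{\pi\in P}U^\pi$ contains exactly one word representing an element of $C$, and this word has minimal weight among all words over $S$ representing elements of $C$; (2) each $\phi_\pi(U^\pi)$ is a polyhedral subset of $\mathbb Z^{m_\pi}$.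 $n$-regular languages. An asynchronous $n$-variable finite state automaton over a finite alphabet $A$ is a finite directed graph with edges labelled by elements of $(A\cup\{\varepsilon\})^n$ having at most one non-$\varepsilon$ entry, with a start vertex and a set of accept vertices. It accepts $\mathbf w\in(A^* )^n$ if $\mathbf w$ is obtained by concatenating coordinatewise the labels of a directed path from the start vertex to an accept vertex and deleting $\varepsilon$'s. A subset of $(A^* )^n$ is $n$-regular if it is the set of tuples accepted by such an automaton. EDT0L languages. A language $L\subseteq A^*$ is EDT0L if there are a finite alphabet $C\supseteq A$, a word $w_0\in C^*$ and a rational subset $\mathcal R$ of the monoid $\mathrm{End}(C^* )$ (the image of a regular language over some finite set $B\subset\mathrm{End}(C^* )$) with $L=\{\phi(w_0):\phi\in\mathcal R\}\cap A^*$. *)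

(* Defs.v *)
From mathcomp Require Import all_boot all_order all_algebra finmap.
From mathcomp Require Import boolp classical_sets functions cardinality.

Set Implicit Arguments.
Unset Strict Implicit.
Unset Printing Implicit Defensive.

Local Open Scope classical_set_scope.

Record dfa (A : finType) := Dfa {
  dfa_state : finType;
  dfa_start : dfa_state;
  dfa_accept : {set dfa_state};
  dfa_step : dfa_state -> A -> dfa_state }.

Definition dfa_lang (A : finType) (M : dfa A) : set (seq A) :=
  [set w | foldl (@dfa_step A M) (dfa_start M) w \in dfa_accept M].

(* [None] stands for the empty word in a label. *)
Record async_automaton (n : nat) (A : finType) := AsyncAutomaton {
  aa_state : finType;
  aa_start : aa_state;
  aa_accept : {set aa_state};
  aa_edges : {set aa_state * n.-tuple (option A) * aa_state};
  aa_edgesP : forall e, e \in aa_edges -> #|[pred i | tnth e.1.2 i != None]| <= 1 }.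

Fixpoint aa_path n (A : finType) (M : async_automaton n A) (q : aa_state M)
    (p : seq (n.-tuple (option A) * aa_state M)) : bool :=
  if p is (l, q') :: p' then ((q, l, q') \in aa_edges M) && aa_path q' p'
  else q \in aa_accept M.

Definition aa_lang n (A : finType) (M : async_automaton n A) :
    set (n.-tuple (seq A)) :=
  [set w | exists2 p, aa_path (aa_start M) p &
           forall i, tnth w i = pmap (fun e => tnth e.1 i) p].

Definition n_regular n (A : finType) (L : set (n.-tuple (seq A))) : Prop :=
  exists M : async_automaton n A, L = aa_lang M.

(* An endomorphism of the free monoid on C is given by the images of the
   letters. *)
Definition free_endo (C : finType) := {ffun C -> seq C}.

Definition endo_app (C : finType) (f : free_endo C) (w : seq C) : seq C :=
  flatten [seq f c | c <- w].

Definition EDT0L (A : finType) (L : set (seq A)) : Prop :=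
  exists (C : finType) (inC : A -> C) (w0 : seq C)
         (B : {fset free_endo C}) (M : dfa B),
    injective inC /\
    L = [set w | exists2 h : seq B, dfa_lang M h &
                 map inC w = foldr (fun b u => endo_app (val b) u) w0 h].

Section Polyhedral.
Local Open Scope ring_scope.

Definition dot m (u z : 'rV[int]_m) : int := \sum_i u 0 i * z 0 i.

Inductive elementary m :=
  | ElemEq of 'rV[int]_m & int
  | ElemMod of 'rV[int]_m & int & nat
  | ElemGt of 'rV[int]_m & int.

(* Congruence modulo 0 is equality, as [(x %% 0)%Z = x]. *)
Definition elementary_region m (e : elementary m) : set 'rV[int]_m :=
  match e with
  | ElemEq u a => [set z | dot u z = a]
  | ElemMod u a b => [set z | (dot u z = a %[mod b%:Z])%Z]
  | ElemGt u a => [set z | a < dot u z]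
  end.

Definition polyhedral m (V : set 'rV[int]_m) : Prop :=
  exists F : seq (seq (elementary m)),
    V = \big[setU/set0]_(E <- F) \big[setI/setT]_(e <- E) elementary_region e.

End Polyhedral.

Local Open Scope group_scope.

Definition subgroup (G : groupType) (H : set G) : Prop :=
  group_closed (mem H).

Definition singletons (G : groupType) : set (set G) :=
  [set [set g] | g in setT].
Arguments singletons : clear implicits.

Definition left_cosets (G : groupType) (H : set G) : set (set G) :=
  [set [set g * h | h in H] | g in setT].

Definition conjugacy_classes (G : groupType) : set (set G) :=
  [set [set g ^ h | h in setT] | g in setT].
Arguments conjugacy_classes : clear implicits.

Definition free_abelian (G : groupType) (k : nat) (Z : set G) : Prop :=
  exists f : 'rV[int]_k -> G,
    [/\ injective f, {morph f : u v / (u + v)%R >-> u * v} & range f = Z].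

Definition value (G : groupType) (A : {fset G}) (w : seq A) : G :=
  \prod_(a <- w) val a.

Definition monoid_generates (G : groupType) (A : {fset G}) : Prop :=
  forall g, exists w : seq A, value w = g.

Definition rational (G : groupType) (V : set G) : Prop :=
  exists (A : {fset G}) (M : dfa A),
    monoid_generates A /\ V = [set value w | w in dfa_lang M].

Inductive gterm (X : Type) :=
  | GVar of X
  | GOne
  | GMul of gterm X & gterm X
  | GInv of gterm X.
Arguments GOne {X}.

Fixpoint geval (G : groupType) (X : Type) (e : X -> G) (t : gterm X) : G :=
  match t with
  | GVar x => e x
  | GOne => 1
  | GMul t1 t2 => geval e t1 * geval e t2
  | GInv t1 => (geval e t1)^-1
  end.

(* [inl i] is the i-th variable, [inr c] the coefficient c. *)
Definition equation (G : groupType) (q : nat) : Type :=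
  gterm ('I_q + G) * gterm ('I_q + G).

Definition solves (G : groupType) q (x : {ffun 'I_q -> G}) (e : equation G q) :=
  let env a := match a with inl i => x i | inr c => c end in
  geval env e.1 = geval env e.2.

Definition algebraic (G : groupType) q (V : set {ffun 'I_q -> G}) : Prop :=
  exists (m : nat) (E : 'I_m -> equation G q),
    V = [set x | forall j, solves x (E j)].

Inductive gformula :=
  | FEq of gterm nat & gterm nat
  | FFalse
  | FNot of gformula
  | FAnd of gformula & gformula
  | FOr of gformula & gformula
  | FImp of gformula & gformula
  | FForall of nat & gformula
  | FExists of nat & gformula.

(* As in [GRing.holds], the environment lists the values of the variables
   0, 1, ...; variables out of range have value 1. *)
Fixpoint gholds (G : groupType) (e : seq G) (f : gformula) : Prop :=
  match f with
  | FEq t1 t2 => geval (nth 1 e) t1 = geval (nth 1 e) t2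
  | FFalse => False
  | FNot f1 => ~ gholds e f1
  | FAnd f1 f2 => gholds e f1 /\ gholds e f2
  | FOr f1 f2 => gholds e f1 \/ gholds e f2
  | FImp f1 f2 => gholds e f1 -> gholds e f2
  | FForall i f1 => forall g : G, gholds (set_nth 1 e i g) f1
  | FExists i f1 => exists g : G, gholds (set_nth 1 e i g) f1
  end.

(* Variables 0, ..., q-1 are x_1, ..., x_q; the following ones are the
   parameters. *)
Definition definable (G : groupType) q (V : set {ffun 'I_q -> G}) : Prop :=
  exists (f : gformula) (m : seq G),
    V = [set x | gholds ([seq x i | i <- enum 'I_q] ++ m) f].

(* A subset of G seen as a subset of G^1. *)
Definition as_pow1 (G : groupType) (V : set G) : set {ffun 'I_1 -> G} :=
  [set x | V (x ord0)].

Definition ball (G : groupType) (A : {fset G}) (d : nat) : {fset G} :=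
  (\bigcup_(j <- iota 1 d) [fset value (tval t) | t in {: j.-tuple A}])%fset.

Definition expresses (G : groupType) (A : {fset G}) (d : nat)
    (w : seq A) (g : G) : Prop :=
  0 < size w <= d /\ value w = g.

Lemma ballP (G : groupType) (A : {fset G}) d (g : G) :
  g \in ball A d <-> exists w : seq A, expresses d w g.
Proof.
split=> [/bigfcupP[j]|[w [w_d <-]]].
  rewrite mem_iota add1n ltnS andbT => j_d /imfsetP[t _ ->].
  by exists (tval t); split=> //; rewrite size_tuple.
apply/bigfcupP; exists (size w); first by rewrite mem_iota add1n ltnS andbT.
by apply/imfsetP; exists (in_tuple w).
Qed.

Definition weight (T : Type) (wt : T -> nat) (w : seq T) : nat :=
  (\sum_(a <- w) wt a)%N.

Lemma ex_expression_weight (G : groupType) (A : {fset G}) d (wt : A -> nat)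
    (s : ball A d) :
  exists m, `[< exists2 w, expresses d w (val s) & weight wt w = m >].
Proof.
have [w w_s] := (ballP _ _ _).1 (valP s).
by exists (weight wt w); apply/asboolP; exists w.
Qed.

Definition ball_wt (G : groupType) (A : {fset G}) d (wt : A -> nat)
    (s : ball A d) : nat :=
  ex_minn (ex_expression_weight wt s).

(* A finitely generated group admits such data exactly when it is virtually
   abelian.  [lattice] is the chosen normal subgroup Z^k and [lattice_index] its
   index d; [lattice_letters] is the chosen numbering x_1, ..., x_r of X. *)
Record setting (G : groupType) := Setting {
  gens : {fset G};
  gens_generate : monoid_generates gens;
  gen_wt : gens -> nat;
  gen_wt_gt0 : forall s, 0 < gen_wt s;
  lattice : set G;
  lattice_subgroup : subgroup lattice;
  lattice_normal : forall g z, lattice z -> lattice (z ^ g);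
  lattice_rank : nat;
  lattice_free : free_abelian lattice_rank lattice;
  lattice_index : nat;
  lattice_indexP : (left_cosets lattice #= `I_lattice_index)%card;
  lattice_letters : seq (ball gens lattice_index);
  lattice_letters_uniq : uniq lattice_letters;
  lattice_lettersP : forall s, s \in lattice_letters <-> lattice (val s) }.

Section Patterns.
Variables (G : groupType) (D : setting G).

(* The alphabet S. *)
Definition letters : {fset G} := ball (gens D) (lattice_index D).

Definition letter_wt : letters -> nat := ball_wt (@gen_wt G D).

Definition patterns : set (seq letters) :=
  [set pi | size pi <= lattice_index D /\
            {in pi, forall y, ~ lattice D (val y)}].

Definition pdim (pi : seq letters) : nat :=
  (size pi * size (lattice_letters D) + size (lattice_letters D))%N.

(* The tuple (x_1^{i_1}, ..., x_r^{i_r}, pi_1, x_1^{i_{r+1}}, ...), for v the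
   list of exponents i_1, i_2, ... *)
Fixpoint patterned_tuple (pi : seq letters) (v : seq nat) : seq (seq letters) :=
  let r := size (lattice_letters D) in
  let block := [seq nseq p.1 p.2 | p <- zip (take r v) (lattice_letters D)] in
  if pi is y :: pi' then block ++ [:: y] :: patterned_tuple pi' (drop r v)
  else block.

(* The inverse of the bijection phi_pi. *)
Definition patterned_word (pi : seq letters) (v : (pdim pi).-tuple nat) :
    seq letters :=
  flatten (patterned_tuple pi v).

Definition patterned_words (pi : seq letters) : set (seq letters) :=
  range (@patterned_word pi).

(* phi_pi(U), for U a set of patterned words of pattern pi. *)
Definition phi_image (pi : seq letters) (U : set (seq letters)) :
    set 'rV[int]_(pdim pi) :=
  [set (\row_i (tnth v i)%:Z)%R | v in [set v | U (patterned_word v)]].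

Definition GF (U : seq letters -> set (seq letters)) : set (seq letters) :=
  \bigcup_(pi in patterns) U pi.

Definition GF_of (U : seq letters -> set (seq letters)) (V : set G) :
    set (seq letters) :=
  [set w | GF U w /\ V (value w)].

(* Distinct patterns have disjoint sets of patterned words, so the union [GF U]
   is disjoint. *)
Definition polyhedral_geodesic_system (classes : set (set G))
    (U : seq letters -> set (seq letters)) : Prop :=
  [/\ forall pi, patterns pi -> U pi `<=` patterned_words pi,
      forall c, classes c ->
        (exists! w, GF U w /\ c (value w)) /\
        (forall w, GF U w -> c (value w) ->
         forall w' : seq letters, c (value w') ->
         weight letter_wt w <= weight letter_wt w')
    & forall pi, patterns pi -> polyhedral (@phi_image pi (U pi))].

Definition psi n (L : set (seq letters)) : set (n.-tuple (seq letters)) :=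
  [set t | exists pi (v : (pdim pi).-tuple nat),
     [/\ patterns pi, L (patterned_word v)
       & let p := patterned_tuple pi v in
         tval t = p ++ nseq (n - size p) [::]]].

Definition theta n (t : n.-tuple (seq letters)) : seq letters := flatten t.

Definition geodesic_rep (g : G) (w : seq (gens D)) : Prop :=
  value w = g /\
  forall w', value w' = g -> weight (@gen_wt G D) w <= weight (@gen_wt G D) w'.

(* A choice, for each letter of S, of a minimal-weight expression. *)
Definition expansion (sigma : letters -> seq (gens D)) : Prop :=
  forall s, expresses (lattice_index D) (sigma s) (val s) /\
            weight (@gen_wt G D) (sigma s) = letter_wt s.

Definition expand (sigma : letters -> seq (gens D)) (w : seq letters) :
    seq (gens D) :=
  flatten [seq sigma s | s <- w].

Definition geodesic_language n (L : set (seq letters)) : Prop :=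
  [/\ n_regular (@psi n L),
      forall t, @psi n L t -> forall sigma, expansion sigma ->
        geodesic_rep (value (theta t)) (expand sigma (theta t)),
      @theta n @` (@psi n L) = L,
      EDT0L L
    & forall sigma, expansion sigma -> EDT0L (expand sigma @` L)].

End Patterns.

(* Main.v *)
(* Writing g = f(w) t, with w in Z^k and t among finitely many coset representatives,
   interprets G in Presburger arithmetic: multiplication becomes affine in the
   coordinates w.  Hence definable (in particular algebraic) sets and the conjugacy
   relation are Presburger definable; so are subgroups, because subgroups of Z^k are
   finitely generated, and rational sets, by Parikh's theorem.  In G^q no compatibility
   of the two lattices is needed: a homomorphism maps the words of a fixed pattern to
   products of constants and powers g^n, and g^n is affine in n on residue classes.

   By Cooper's quantifier elimination, Presburger sets are the polyhedral sets, which
   gives the geodesic systems: every element has a geodesic patterned word, and one word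
   of each class is selected by minimizing definable keys.  Presburger subsets of N^m
   are finite unions of sets c + N p_1 + ... + N p_j (Dickson's lemma).  The tuples
   psi(L) are thus spelled by an automaton writing c and then looping on the p_i, and
   an automaton on tuples becomes an EDT0L system with one nonterminal per coordinate. *)

Require Import Defs.
From mathcomp Require Import all_boot all_order all_algebra finmap.
From mathcomp Require Import boolp classical_sets functions cardinality.
From mathcomp Require Import zify ring lra.

Set Implicit Arguments.
Unset Strict Implicit.
Unset Printing Implicit Defensive.

Import Order.TTheory GRing.Theory Num.Theory.
Local Open Scope ring_scope.

(** * Presburger arithmetic *)

(** That a geodesic word needs at most d pattern letters rests on counting cosets of the lattice. A
    word over the generators is read letter by letter, keeping an output over S and a pending
    segment. When the segment reaches a coset that the output has not visited, it is output as a
    single letter of S, so each letter of Y is paid for by a new coset. When it returns to one of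
    its own cosets, the closed part is a lattice element; it is moved back, as a letter of X, to an
    earlier place where the output visits that coset, and it commutes with everything it passes over
    because that is a lattice element too. So the segment runs through distinct cosets and stays
    shorter than d, which is why products of at most d generators suffice as letters.

    Exponent vectors are integer functions on an arbitrary finite type: a quantifier passes from [I]
    to [option I] or [I + J] without renumbering variables. Words become total functions of such
    vectors through absolute values, and nonnegativity is carried as a separate condition. *)

Lemma big_option (I : finType) (F : option I -> int) :
  \sum_o F o = F None + \sum_i F (Some i).
Proof.
rewrite (bigD1 None) //=; congr (_ + _).
rewrite (reindex_omap (Some : I -> option I) id) => [|[]//].
by apply: eq_bigl => i; rewrite eqxx.
Qed.

Definition ocons (T : Type) (I : Type) (x : T) (e : I -> T) (o : option I) : T :=
  if o is Some i then e i else x.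

Definition sumenv (T : Type) (I J : Type) (e : I -> T) (w : J -> T) (s : I + J) : T :=
  match s with inl i => e i | inr j => w j end.

Section AffineMaps.
Variable I : finType.
Implicit Types (e : I -> int) (f g : (I -> int) -> int).

Definition affine f :=
  exists (u : I -> int) (a : int), forall e, f e = \sum_i u i * e i + a.

Lemma affine_const (a : int) : affine (fun=> a).
Proof.
exists (fun=> 0), a => e.
by rewrite big1 ?add0r // => i _; rewrite mul0r.
Qed.

Lemma affine_var i : affine (fun e => e i).
Proof.
exists (fun j => (j == i)%:Z), 0 => e; rewrite addr0 (bigD1 i) //= eqxx mul1r.
by rewrite big1 ?addr0 // => j /negbTE->; rewrite mul0r.
Qed.

Lemma affineD f g : affine f -> affine g -> affine (fun e => f e + g e).
Proof.
move=> [u [a fE]] [v [b gE]]; exists (fun i => u i + v i), (a + b) => e.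
rewrite fE gE addrACA -big_split /=; congr (_ + _).
by apply: eq_bigr => i _; rewrite mulrDl.
Qed.

Lemma affineZ c f : affine f -> affine (fun e => c * f e).
Proof.
move=> [u [a fE]]; exists (fun i => c * u i), (c * a) => e.
rewrite fE mulrDr big_distrr /=; congr (_ + _).
by apply: eq_bigr => i _; rewrite mulrA.
Qed.

Lemma affineZr c f : affine f -> affine (fun e => f e * c).
Proof.
move=> /(affineZ c)[u [a fE]]; exists u, a => e.
by rewrite mulrC fE.
Qed.

Lemma affineN f : affine f -> affine (fun e => - f e).
Proof.
move=> /(affineZ (-1))[u [a fE]]; exists u, a => e.
by rewrite -fE mulN1r.
Qed.

Lemma affineB f g : affine f -> affine g -> affine (fun e => f e - g e).
Proof. by move=> fA gA; apply: affineD => //; apply: affineN. Qed.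

Lemma affine_sum (J : Type) (r : seq J) (F : J -> (I -> int) -> int) :
  (forall j, affine (F j)) -> affine (fun e => \sum_(j <- r) F j e).
Proof.
move=> FA; elim: r => [|j r IHr].
  have [u [a cE]] := affine_const 0; exists u, a => e.
  by rewrite big_nil -cE.
have [u [a fE]] := affineD (FA j) IHr; exists u, a => e.
by rewrite big_cons fE.
Qed.

End AffineMaps.

Lemma affine_comp (I J : finType) (f : (J -> int) -> int) (h : J -> (I -> int) -> int) :
  affine f -> (forall j, affine (h j)) -> affine (fun e => f (fun j => h j e)).
Proof.
move=> [u [a fE]] hA.
have [v [b gE]] := affineD
  (affine_sum (index_enum J) (fun j => affineZ (u j) (hA j))) (affine_const I a).
by exists v, b => e; rewrite fE -gE.
Qed.

Section Presburger.
Variable I : finType.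

(* [(u, a, 0)] stands for [0 < u.e + a] and [(u, a, b)], with [b > 0], for
   [b | u.e + a]. *)
Definition atom : Type := (I -> int) * int * nat.

Definition form_eval (u : I -> int) (a : int) (e : I -> int) : int :=
  \sum_i u i * e i + a.

Definition atom_holds (e : I -> int) (t : atom) : bool :=
  let: (u, a, b) := t in
  if b == 0%N then 0 < form_eval u a e else (b%:Z %| form_eval u a e)%Z.

Definition dnf_holds (e : I -> int) (F : seq (seq atom)) : bool :=
  has (all (atom_holds e)) F.

(** Only strict inequalities and divisibilities, without negation or quantifiers: closure under both
    is proved below. *)
Definition presburger (P : (I -> int) -> Prop) : Prop :=
  exists F, forall e, P e <-> dnf_holds e F.

Implicit Types (P Q : (I -> int) -> Prop).

Lemma eq_presburger P Q : (forall e, P e <-> Q e) -> presburger P -> presburger Q.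
Proof.
by move=> eqPQ [F PE]; exists F => e; rewrite -eqPQ PE.
Qed.

Lemma presburger_gt0 f : affine f -> presburger (fun e => 0 < f e).
Proof.
move=> [u [a fE]]; exists [:: [:: (u, a, 0%N)]] => e.
by rewrite /= /form_eval /= -fE orbF andbT.
Qed.

Lemma presburger_dvd f (b : nat) : (0 < b)%N -> affine f ->
  presburger (fun e => (b%:Z %| f e)%Z).
Proof.
move=> b_gt0 [u [a fE]]; exists [:: [:: (u, a, b)]] => e.
by rewrite /= /form_eval /= -fE orbF andbT -if_neg -lt0n b_gt0.
Qed.

Lemma presburger_false : presburger (fun=> False).
Proof. by exists [::] => e. Qed.

Lemma presburger_true : presburger (fun=> True).
Proof. by exists [:: [::]] => e. Qed.

Lemma presburger_or P Q : presburger P -> presburger Q ->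
  presburger (fun e => P e \/ Q e).
Proof.
move=> [F PE] [H QE]; exists (F ++ H) => e.
rewrite /dnf_holds has_cat PE QE.
by split=> [/orP|/orP].
Qed.

Lemma presburger_and P Q : presburger P -> presburger Q ->
  presburger (fun e => P e /\ Q e).
Proof.
move=> [F PE] [H QE]; exists [seq C ++ E | C <- F, E <- H] => e.
rewrite PE QE; split=> [[/hasP[C CF Ce] /hasP[E EH Ee]]|].
  apply/hasP; exists (C ++ E); last by rewrite all_cat Ce.
  by apply/allpairsPdep; exists C, E.
move=> /hasP[_ /allpairsPdep[C [E [CF EH ->]]]]; rewrite all_cat => /andP[Ce Ee].
by split; apply/hasP; [exists C|exists E].
Qed.

Lemma presburger_in (T : eqType) (r : seq T) (P : T -> (I -> int) -> Prop) :
  (forall x, presburger (P x)) ->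
  presburger (fun e => exists2 x, x \in r & P x e).
Proof.
move=> Ppres; elim: r => [|x r IHr] /=.
  by apply: eq_presburger presburger_false => e; split=> // -[].
apply: eq_presburger (presburger_or (Ppres x) IHr) => e; split.
  by move=> [Pe|[y yr Pe]]; [exists x|exists y]; rewrite // inE ?eqxx ?yr ?orbT.
by move=> [y]; rewrite inE => /predU1P[->|yr Pe]; [left|right; exists y].
Qed.

Lemma presburger_has (T : Type) (r : seq T) (P : T -> (I -> int) -> Prop) :
  (forall x, presburger (P x)) ->
  presburger (fun e => has (fun x => `[< P x e >]) r).
Proof.
move=> Ppres; elim: r => [|x r IHr] /=.
  by apply: eq_presburger presburger_false => e; split.
apply: eq_presburger (presburger_or (Ppres x) IHr) => e.
by split=> [[Pe|->]|/orP[/asboolP|]]; [apply/orP; left; apply/asboolP|rewrite orbT|left|right].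
Qed.

Lemma presburger_all (T : Type) (r : seq T) (P : T -> (I -> int) -> Prop) :
  (forall x, presburger (P x)) ->
  presburger (fun e => all (fun x => `[< P x e >]) r).
Proof.
move=> Ppres; elim: r => [|x r IHr] /=.
  by apply: eq_presburger presburger_true => e; split.
apply: eq_presburger (presburger_and (Ppres x) IHr) => e.
by split=> [[/asboolP-> ->]|/andP[/asboolP]].
Qed.

Lemma presburger_exists_fin (T : finType) (P : T -> (I -> int) -> Prop) :
  (forall x, presburger (P x)) -> presburger (fun e => exists x, P x e).
Proof.
move=> /(presburger_has (enum T)); apply: eq_presburger => e.
split=> [/hasP[x _ /asboolP]|[x Pxe]]; first by exists x.
by apply/hasP; exists x; [rewrite mem_enum|apply/asboolP].
Qed.

Lemma presburger_forall_fin (T : finType) (P : T -> (I -> int) -> Prop) :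
  (forall x, presburger (P x)) -> presburger (fun e => forall x, P x e).
Proof.
move=> /(presburger_all (enum T)); apply: eq_presburger => e.
split=> [/allP PE x|Pe]; first by apply/asboolP/PE; rewrite mem_enum.
by apply/allP => x _; apply/asboolP.
Qed.

Lemma presburger_const (p : Prop) : presburger (fun=> p).
Proof.
have [pT|pF] := pselect p.
  by apply: eq_presburger presburger_true.
by apply: eq_presburger presburger_false.
Qed.

(** Turns a negated divisibility into a finite disjunction over the nonzero residues, so that normal
    forms stay free of negation. *)
Lemma not_dvdz_residue (b : nat) (z : int) : (0 < b)%N ->
  ~ (b%:Z %| z)%Z <-> exists j : 'I_b, (0 < j)%N /\ (b%:Z %| z - j%:Z)%Z.
Proof.
move=> b_gt0; have b_neq0 : b%:Z != 0 by lia.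
split=> [bNz|[j [j_gt0 bzj]] bz]; last first.
  have := rpredB bz bzj; rewrite opprB addrC subrK /= dvdzE /=.
  by move=> /(dvdn_leq j_gt0); rewrite leqNgt ltn_ord.
have r_ge0 := modz_ge0 z b_neq0; have := ltz_mod z b_neq0.
move rE : (z %% b%:Z)%Z r_ge0 => [r|//] _ r_lt.
have rb : (r < b)%N by lia.
exists (Ordinal rb) => /=; split.
  rewrite lt0n; apply: contra_notN bNz => /eqP r0.
  by apply/dvdz_mod0P; rewrite rE r0.
by rewrite -rE {1}(divz_eq z b) addrK dvdz_mull.
Qed.

Lemma presburger_not P : presburger P -> presburger (fun e => ~ P e).
Proof.
case=> F PE; suff: presburger (fun e => ~ dnf_holds e F).
  by apply: eq_presburger => e; rewrite PE.
have natom t : presburger (fun e => ~ atom_holds e t).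
  case: t => [[u a] b] /=; case: eqP => [_|/eqP b_neq0].
    apply: eq_presburger (presburger_gt0 (f := fun e => 1 - form_eval u a e) _).
      by move=> e; split; lia.
    by apply: affineB; [apply: affine_const|exists u, a].
  have b_gt0 : (0 < b)%N by rewrite lt0n.
  apply: (eq_presburger (P := fun e => exists j : 'I_b,
    (0 < j)%N /\ (b%:Z %| form_eval u a e - j%:Z)%Z)).
    by move=> e; rewrite not_dvdz_residue.
  apply: presburger_exists_fin => j; apply: presburger_and.
    exact: presburger_const.
  apply: presburger_dvd => //.
  by apply: affineB; [exists u, a|apply: affine_const].
elim: F {PE} => [|C F IHF].
  by apply: eq_presburger presburger_true.
suff nC : presburger (fun e => ~ all (atom_holds e) C).
  apply: eq_presburger (presburger_and nC IHF) => e /=.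
  split=> [[nCe nFe] /orP[]//|nCFe].
  by split=> h; apply: nCFe; rewrite h ?orbT.
elim: C => [|t C IHC].
  by apply: eq_presburger presburger_false => e; split.
apply: eq_presburger (presburger_or (natom t) IHC) => e /=.
split=> [[nt|nC] /andP[]//|ntC]; case: (boolP (atom_holds e t)) => [et|]; last by left.
by right=> eC; apply: ntC; rewrite et.
Qed.

Lemma presburger_imp P Q : presburger P -> presburger Q ->
  presburger (fun e => P e -> Q e).
Proof.
move=> /presburger_not Pp Qp; apply: eq_presburger (presburger_or Pp Qp) => e.
split=> [[]//|PQ]; have [/PQ|] := pselect (P e); by [right|left].
Qed.

Lemma presburger_lt f g : affine f -> affine g -> presburger (fun e => f e < g e).
Proof.
move=> fA gA; apply: eq_presburger (presburger_gt0 (affineB gA fA)) => e.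
by rewrite subr_gt0.
Qed.

Lemma presburger_le f g : affine f -> affine g -> presburger (fun e => f e <= g e).
Proof.
move=> fA gA; apply: eq_presburger (presburger_not (presburger_lt gA fA)) => e.
by rewrite leNgt; split=> /negP.
Qed.

Lemma presburger_eq f g : affine f -> affine g -> presburger (fun e => f e = g e).
Proof.
move=> fA gA.
apply: eq_presburger (presburger_and (presburger_le fA gA) (presburger_le gA fA)) => e.
by split=> [[fg gf]|->//]; apply/eqP; rewrite eq_le fg gf.
Qed.

End Presburger.

Lemma presburger_comp (I J : finType) (P : (J -> int) -> Prop)
    (h : J -> (I -> int) -> int) :
  presburger P -> (forall j, affine (h j)) -> presburger (fun e => P (fun j => h j e)).
Proof.
move=> [F PE] hA.
suff: presburger (fun e => dnf_holds (fun j => h j e) F).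
  by apply: eq_presburger => e; rewrite PE.
have := @presburger_has I _ F (fun C e => all (atom_holds (fun j => h j e)) C).
case=> [C|H HE]; last first.
  by exists H => e; rewrite -HE; rewrite (eq_has (fun=> asboolb _)).
have := @presburger_all I _ C (fun t e => atom_holds (fun j => h j e) t).
case=> [[[u a] b]|H HE]; last first.
  by exists H => e; rewrite -HE; rewrite (eq_all (fun=> asboolb _)).
have fA : affine (fun e => form_eval u a (fun j => h j e)).
  by apply: affine_comp => //; exists u, a.
rewrite /=; case: eqP => [_|/eqP]; first exact: presburger_gt0.
by rewrite -lt0n => b_gt0; apply: presburger_dvd.
Qed.

(** * Quantifier elimination *)

Lemma form_eval_ocons (I : finType) (u : option I -> int) a x (e : I -> int) :
  form_eval u a (ocons x e) = u None * x + form_eval (u \o Some) a e.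
Proof. by rewrite /form_eval big_option addrA. Qed.


(* Cooper's argument: let M be a common multiple of the moduli and let x be the
   least solution in N.  As x - M is not a solution, it violates a lower bound
   [0 < c x + f], so [c x + f = j] for some 0 < j <= c M. *)
Lemma cooper_bound (I : finType) (C : seq (atom (option I))) (e : I -> int) (x0 : int) :
  (forall x, all (atom_holds (ocons x e)) C -> 0 <= x) ->
  all (atom_holds (ocons x0 e)) C ->
  exists x u a j, [/\ (u, a, 0%N) \in C, 0 < u None,
    j \in iota 1 (`|u None| * \prod_(t <- C) maxn 1 t.2),
    u None * x + form_eval (u \o Some) a e = j%:Z
    & all (atom_holds (ocons x e)) C].
Proof.
(* Inequality atoms carry the modulus 0; [maxn 1] keeps the product positive. *)
move=> C_ge0 Cx0; set M := (\prod_(t <- C) _)%N.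
have M_gt0 : (0 < M)%N by rewrite prodn_gt0 // => i; rewrite leq_max.
have exn : exists n : nat, all (atom_holds (ocons n%:Z e)) C.
  by exists `|x0|%N; rewrite gez0_abs // C_ge0.
case: (ex_minnP exn) => x Cx xmin.
have /allPn[[[u a] b] tC] : ~~ all (atom_holds (ocons (x%:Z - M%:Z) e)) C.
  apply/negP => CxM; have xM_ge0 := C_ge0 _ CxM.
  have := xmin `|x%:Z - M%:Z|%N; rewrite gez0_abs // => /(_ CxM); lia.
have := allP Cx _ tC; rewrite /= !form_eval_ocons.
set c := u None; set f := form_eval _ _ e.
case: eqP tC => [->|/eqP b_neq0] tC.
  move=> cx_gt0 cxM; exists x%:Z, u, a, (absz (c * x%:Z + f)); split=> //.
  - by rewrite -/c; nia.
  - by rewrite mem_iota -/c; nia.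
  - by rewrite -/c -/f; lia.
move=> bcx; apply: contraNP => _; rewrite mulrBr addrAC.
apply: rpredB => //=; apply: dvdz_mull; rewrite dvdzE /= /M.
apply: dvdn_trans (_ : (maxn 1 b %| _)%N); first by rewrite (maxn_idPr _) // lt0n.
by rewrite (big_rem _ tC) dvdn_mulr.
Qed.

(** Substitutes x = f / c without dividing: each form is multiplied by c > 0, and the modulus of a
    divisibility with it. *)
Lemma atom_holds_subst (I : finType) (t : atom (option I)) (e : I -> int) (x c f : int) :
  0 < c -> c * x = f ->
  atom_holds (ocons x e) t =
    let: (u, a, b) := t in
    let g := u None * f + c * form_eval (u \o Some) a e in
    if b == 0%N then 0 < g else ((`|c| * b)%:Z %| g)%Z.
Proof.
case: t => [[u a] b] c_gt0 cxf /=.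
have -> : u None * f + c * form_eval (u \o Some) a e =
          c * form_eval u a (ocons x e).
  by rewrite form_eval_ocons -cxf; ring.
case: eqP => _; first by rewrite pmulr_rgt0.
by rewrite PoszM gtz0_abs // dvdz_mul2l // gt_eqF.
Qed.

Lemma presburger_ex (I : finType) (P : int -> (I -> int) -> Prop) :
  presburger (fun e : option I -> int => P (e None) (fun i => e (Some i))) ->
  presburger (fun e => exists x, P x e).
Proof.
(* A least solution needs a lower bound, so nonnegative x come first; negative x are reflected at
   the end. *)
have ex_nneg (Q : int -> (I -> int) -> Prop) :
    presburger (fun e : option I -> int => Q (e None) (fun i => e (Some i))) ->
    (forall x e, Q x e -> 0 <= x) -> presburger (fun e => exists x, Q x e).
  move=> [F QE] Q_ge0.
  have {}QE x e : Q x e <-> dnf_holds (ocons x e) F by rewrite -QE.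

  (* The atom 0 < x + 1 makes every solution of [pos :: C] nonnegative, as [cooper_bound]
     requires. *)
  pose pos : atom (option I) := (fun o => (o == None)%:Z, 1, 0%N).
  have posE x e : atom_holds (ocons x e) pos = (0 <= x).
    rewrite /= form_eval_ocons /form_eval /= mul1r big1 ?add0r; first by lia.
    by move=> i _; rewrite mul0r.
  pose bnd C (u : option I -> int) := (`|u None| * \prod_(t <- pos :: C) maxn 1 t.2)%N.
  pose f (t : atom (option I)) (j : nat) e : int :=
    j%:Z - form_eval (t.1.1 \o Some) t.1.2 e.
  pose g (s t : atom (option I)) j e : int :=
    s.1.1 None * f t j e + t.1.1 None * form_eval (s.1.1 \o Some) s.1.2 e.
  pose R (s t : atom (option I)) j e : bool :=
    if s.2 == 0%N then 0 < g s t j e else ((`|t.1.1 None| * s.2)%:Z %| g s t j e)%Z.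
  (* [V] says that the x solving [c * x = f t j e], with c > 0 the coefficient of x in the lower
     bound t, is an integer and satisfies every atom. *)
  pose V C t j e := [/\ t.2 = 0%N, 0 < t.1.1 None,
    (`|t.1.1 None|%:Z %| f t j e)%Z & all (fun s => `[< R s t j e >]) (pos :: C)].
  have fA t j : affine (f t j).
    by apply: affineB; [apply: affine_const|exists (t.1.1 \o Some), t.1.2].
  have gA s t j : affine (g s t j).
    apply: affineD; apply: affineZ; first exact: fA.
    by exists (s.1.1 \o Some), s.1.2.
  apply: (eq_presburger (P := fun e => exists2 C, C \in F & exists2 t, t \in pos :: C &
    exists2 j, j \in iota 1 (bnd C t.1.1) & V C t j e)); last first.
    apply: presburger_in => C; apply: presburger_in => t; apply: presburger_in => j.
    case: (posnP t.2) => [t2|t2]; last first.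
      by apply: eq_presburger (presburger_false I) => e; split=> // -[t2E]; rewrite t2E in t2.
    case: (ltP 0 (t.1.1 None)) => [c_gt0|c_le0]; last first.
      by apply: eq_presburger (presburger_false I) => e; split=> // -[_]; rewrite ltNge c_le0.
    apply: (eq_presburger (P := fun e => (`|t.1.1 None|%:Z %| f t j e)%Z /\
        all (fun s => `[< R s t j e >]) (pos :: C))); first by move=> e; split=> [[]|[]].
    apply: presburger_and; first by apply: presburger_dvd; rewrite // absz_gt0 gt_eqF.
    apply: presburger_all => s; rewrite /R; case: eqP => [_|/eqP s2].
      exact: presburger_gt0.
    by apply: presburger_dvd; rewrite // muln_gt0 absz_gt0 gt_eqF // lt0n.
  move=> e; split=> [[C CF [t tC [j _ [t2 c_gt0 cf CR]]]]|[x Qx]].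
    have cx : t.1.1 None * (f t j e %/ t.1.1 None)%Z = f t j e.
      by rewrite mulrC divzK // -[t.1.1 None]gtz0_abs.
    exists (f t j e %/ t.1.1 None)%Z; rewrite QE; apply/hasP; exists C => //.
    suff : all (atom_holds (ocons (f t j e %/ t.1.1 None)%Z e)) (pos :: C) by case/andP.
    apply: sub_all CR => s /asboolP; rewrite (atom_holds_subst _ _ c_gt0 cx) /R.
    by case: s => [[u a] b].
  have := Qx; rewrite QE => /hasP[C CF Cx].
  have Dx : all (atom_holds (ocons x e)) (pos :: C).
    by apply/andP; split=> //; rewrite posE (Q_ge0 _ _ Qx).
  have Dpos y : all (atom_holds (ocons y e)) (pos :: C) -> 0 <= y.
    by case/andP; rewrite posE.
  have [y [u [a [j [uC u_gt0 jM uy Cy]]]]] := cooper_bound Dpos Dx.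
  exists C => //; exists (u, a, 0%N) => //; exists j => //.
  have cy : u None * y = f (u, a, 0%N) j e by rewrite /f -uy; ring.
  split=> //; first by rewrite -cy gtz0_abs //; apply: dvdz_mulr.
  apply: sub_all Cy => s; rewrite (atom_holds_subst _ _ u_gt0 cy) => sy.
  by apply/asboolP; case: s sy => [[u' a'] b'].
move=> Ppres.
have PN : presburger (fun e : option I -> int => P (- e None) (fun i => e (Some i))).
  apply: (presburger_comp (h := fun o e => if o is None then - e None else e o) Ppres).
  by case=> [i|]; [|apply: affineN]; apply: affine_var.
have pos_pres (Q : int -> (I -> int) -> Prop) :
    presburger (fun e : option I -> int => Q (e None) (fun i => e (Some i))) ->
    presburger (fun e => exists x, 0 <= x /\ Q x e).
  move=> Qpres; apply: ex_nneg => [|x e []//]; apply: presburger_and => //.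
  by apply: presburger_le; [apply: affine_const|apply: affine_var].
apply: eq_presburger (presburger_or (pos_pres _ Ppres)
  (pos_pres (fun x e => P (- x) e) PN)) => e.
split=> [[[x [_ Px]]|[x [_ Px]]]|[x Px]]; [by exists x|by exists (- x)|].
case: (lerP 0 x) => x0; [left; exists x|right; exists (- x)] => //.
by rewrite opprK; split=> //; lia.
Qed.

(** The quantified variables keep their slots in [K], where the old values are ignored; this allows
    induction on a list of variables instead of on a type. *)
Lemma presburger_exists_on (K : finType) (s : seq K) (Q : (K -> int) -> Prop) :
  presburger Q ->
  presburger (fun e => exists e', (forall k, k \notin s -> e' k = e k) /\ Q e').
Proof.
elim: s Q => [|k s IHs] Q Qpres.
  apply: eq_presburger Qpres => e; split=> [Qe|[e' [e'e]]]; first by exists e.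
  by rewrite (_ : e' = e) //; apply/funext => k; apply: e'e.
pose upd (e : K -> int) x l := if l == k then x else e l.
have /IHs : presburger (fun e => exists x, Q (upd e x)).
  apply: presburger_ex; apply: (presburger_comp
    (h := fun l (e : option K -> int) => if l == k then e None else e (Some l))) => // l.
  by case: eqP => _; apply: affine_var.
apply: eq_presburger => e; split=> [[e' [e'e [x Qx]]]|[e' [e'e Qe']]].
  exists (upd e' x); split=> // l; rewrite inE negb_or => /andP[/negbTE lk ls].
  by rewrite /upd lk e'e.
exists (fun l => if l \in s then e' l else e l); split; first by move=> l /negbTE->.
exists (e' k); rewrite (_ : upd _ _ = e') //; apply/funext => l; rewrite /upd.
case: eqP => [->//|/eqP lk]; case: ifP => // ls.
by rewrite e'e // inE negb_or lk ls.
Qed.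

Lemma presburger_exists (I J : finType) (P : (J -> int) -> (I -> int) -> Prop) :
  presburger (fun e : I + J -> int => P (fun j => e (inr j)) (fun i => e (inl i))) ->
  presburger (fun e => exists w, P w e).
Proof.
move=> /(presburger_exists_on [seq inr j | j <- enum J]) Ppres.
(* The slots of the quantified variables no longer matter and are filled with 0. *)
have /= := presburger_comp (h := fun s (e : I -> int) => sumenv e (fun=> 0) s) Ppres.
case=> [[i|j]|F FE]; [exact: affine_var|exact: affine_const|exists F => e].
rewrite -FE; split=> [[w Pw]|[e' [e'e Pe']]].
  exists (sumenv e w); split=> //= -[//|j] /negP[].
  by apply: map_f; rewrite mem_enum.
exists (fun j => e' (inr j)); congr (P _ _): Pe'; apply/funext => i.
by rewrite e'e //; apply/negP => /mapP[].
Qed.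

Lemma presburger_forall (I J : finType) (P : (J -> int) -> (I -> int) -> Prop) :
  presburger (fun e : I + J -> int => P (fun j => e (inr j)) (fun i => e (inl i))) ->
  presburger (fun e => forall w, P w e).
Proof.
move=> /presburger_not.
move=> /(presburger_exists (P := fun w e => ~ P w e)) /presburger_not.
apply: eq_presburger => e; split=> [nP w|Pe [w]]; last exact.
by apply: contrapT => nPw; apply: nP; exists w.
Qed.

(** * Presburger sets and polyhedral sets *)

Section PresburgerPolyhedral.
Variable m : nat.
Implicit Types V W : set 'rV[int]_m.

Lemma dot_form (u z : 'rV[int]_m) a :
  dot u z + a = form_eval (fun i => u 0 i) a (fun i => z 0 i).
Proof. by []. Qed.

Lemma presburger_polyhedral (P : ('I_m -> int) -> Prop) :
  presburger P -> polyhedral [set z | P (fun i => z 0 i)].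
Proof.
move=> [F PE].
pose region (t : atom 'I_m) : elementary m :=
  let: (u, a, b) := t in let u' := \row_i u i in
  if b == 0%N then ElemGt u' (- a) else ElemMod u' (- a) b.
have regionE t z : elementary_region (region t) z <-> atom_holds (fun i => z 0 i) t.
  case: t => [[u a] b] /=.
  have uE : form_eval u a (fun i => z 0 i) = dot (\row_i u i) z + a.
    by rewrite dot_form /form_eval; under [in RHS]eq_bigr do rewrite mxE.
  rewrite uE; case: eqP => _ /=; first by rewrite -subr_gt0 opprK.
  by rewrite -[X in _ + X]opprK -eqz_mod_dvd; split=> /eqP.
exists [seq [seq region t | t <- C] | C <- F]; apply/seteqP; split=> z /=.
  rewrite PE; elim: F {PE} => //= C F IHF /orP[Cz|Fz]; rewrite big_cons; [left|right].
    elim: C Cz => [|t C IHC] /=; first by rewrite big_nil.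
    by move=> /andP[/regionE tz Cz]; rewrite big_cons; split; last exact: IHC.
  exact: IHF.
rewrite PE; elim: F {PE} => [|C F IHF]; first by rewrite big_nil.
rewrite big_cons => -[Cz|/IHF/=->]; last by rewrite orbT.
apply/orP; left; elim: C Cz => [//|t C IHC]; rewrite big_cons => -[tz /IHC /= ->].
by rewrite andbT; apply/regionE.
Qed.

Lemma polyhedral_presburger V :
  polyhedral V -> presburger (fun e : 'I_m -> int => V (\row_i e i)).
Proof.
case=> F ->; elim: F => [|E F IHF].
  by apply: eq_presburger (presburger_false _) => e; rewrite big_nil; split.
apply: (eq_presburger (P := fun e =>
   (\big[setI/setT]_(t <- E) elementary_region t) (\row_i e i) \/
   (\big[setU/set0]_(E <- F) \big[setI/setT]_(t <- E) elementary_region t) (\row_i e i))).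
  by move=> e; rewrite big_cons.
apply: presburger_or => //; elim: E {F IHF} => [|t E IHE].
  by apply: eq_presburger (presburger_true _) => e; rewrite big_nil; split.
apply: (eq_presburger (P := fun e => elementary_region t (\row_i e i) /\
   (\big[setI/setT]_(t <- E) elementary_region t) (\row_i e i))).
  by move=> e; rewrite big_cons.
apply: presburger_and => //.
have uA (u : 'rV[int]_m) : affine (fun e : 'I_m -> int => dot u (\row_i e i)).
  exists (fun i => u 0 i), 0 => e; rewrite addr0.
  by apply: eq_bigr => i _; rewrite mxE.
case: t => [u a|u a b|u a] /=.
- by apply: presburger_eq => //; apply: affine_const.
- case: (posnP b) => [->|b_gt0].
    apply: eq_presburger (presburger_eq (uA u) (affine_const _ a)) => e.
    by rewrite !modz0.
  apply: eq_presburger (presburger_dvd b_gt0 (affineB (uA u) (affine_const _ a))) => e.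
  by rewrite -eqz_mod_dvd; split=> /eqP.
- by apply: presburger_lt => //; apply: affine_const.
Qed.

End PresburgerPolyhedral.

(** * Semilinear sets *)

Section Semilinear.
Variable V : nmodType.
Implicit Types (A B : V -> Prop) (ps : seq V) (v : V).

(** Lists with repetition replace natural coefficients, which makes sense in any commutative
    monoid. *)
Definition span ps v := exists2 ks : seq V, {subset ks <= ps} & v = \sum_(k <- ks) k.

Definition linear_set (l : V * seq V) v := exists2 w, span l.2 w & v = l.1 + w.

Definition semilinear A :=
  exists L : seq (V * seq V), forall v, A v <-> exists2 l, l \in L & linear_set l v.

Definition star A v := exists2 ks : seq V, (forall k, k \in ks -> A k) & v = \sum_(k <- ks) k.

Lemma span0 ps : span ps 0.
Proof. by exists [::]; rewrite ?big_nil. Qed.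

Lemma spanD ps v w : span ps v -> span ps w -> span ps (v + w).
Proof.
move=> [ks ksP ->] [ls lsP ->]; exists (ks ++ ls); last by rewrite big_cat.
by move=> k; rewrite mem_cat => /orP[/ksP|/lsP].
Qed.

Lemma span_gen ps p : p \in ps -> span ps p.
Proof.
by move=> pps; exists [:: p]; rewrite ?big_seq1 // => k; rewrite inE => /eqP->.
Qed.

Lemma sub_span ps qs v : {subset ps <= qs} -> span ps v -> span qs v.
Proof. by move=> pq [ks ksP ->]; exists ks => // k /ksP/pq. Qed.

Lemma span_sum ps (ks : seq V) :
  (forall k, k \in ks -> span ps k) -> span ps (\sum_(k <- ks) k).
Proof.
move=> ksP; rewrite big_seq; elim/big_ind: _ => //; [exact: span0|exact: spanD].
Qed.

Lemma span_cat ps qs v :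
  span (ps ++ qs) v <-> exists x y, [/\ span ps x, span qs y & v = x + y].
Proof.
split=> [[ks ksP ->]|[x [y [xP yQ ->]]]]; last first.
  by apply: spanD; [apply: sub_span xP|apply: sub_span yQ] => k;
    rewrite mem_cat => ->; rewrite ?orbT.
exists (\sum_(k <- ks | k \in ps) k), (\sum_(k <- ks | k \notin ps) k).
split; last exact: bigID.
  rewrite -big_filter; apply: span_sum => k.
  by rewrite mem_filter => /andP[kps _]; apply: span_gen.
rewrite -big_filter; apply: span_sum => k.
rewrite mem_filter => /andP[kps kks]; apply: span_gen.
by have := ksP k kks; rewrite mem_cat (negbTE kps).
Qed.

Lemma span_cons p ps v :
  span (p :: ps) v <-> exists n w, span ps w /\ v = p *+ n + w.
Proof.
split=> [/(span_cat [:: p] ps)[x [y [[ks ksP ->] yP ->]]]|[n [w [wP ->]]]].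
  exists (size ks), y; split=> //; congr (_ + _).
  rewrite (eq_big_seq (fun=> p)); last by move=> k /ksP; rewrite inE => /eqP.
  by rewrite big_const_seq count_predT iter_addr_0.
apply: spanD; last by apply: sub_span wP => k; rewrite inE => ->; rewrite orbT.
by exists (nseq n p); [move=> k /nseqP[-> _]; rewrite mem_head|rewrite big_nseq iter_addr_0].
Qed.

Lemma eq_semilinear A B : (forall v, A v <-> B v) -> semilinear A -> semilinear B.
Proof. by move=> AB [L AL]; exists L => v; rewrite -AB. Qed.

Lemma semilinear0 : semilinear (fun=> False).
Proof. by exists [::] => v; split=> // -[]. Qed.

Lemma semilinear1 c : semilinear (eq c).
Proof.
exists [:: (c, [::])] => v; split=> [<-|[l]].
  by exists (c, [::]); rewrite ?mem_head //; exists 0; [exact: span0|rewrite addr0].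
rewrite inE => /eqP-> [w [ks ksP ->] ->]; case: ks ksP => [|k ks] ksP.
  by rewrite big_nil addr0.
by have := ksP k (mem_head _ _).
Qed.

Lemma semilinearU A B : semilinear A -> semilinear B -> semilinear (fun v => A v \/ B v).
Proof.
move=> [L AL] [K BK]; exists (L ++ K) => v; rewrite AL BK; split.
  by case=> -[l lL lv]; exists l; rewrite // mem_cat lL ?orbT.
by move=> [l]; rewrite mem_cat => /orP[] lL lv; [left|right]; exists l.
Qed.

Lemma semilinear_in (T : eqType) (r : seq T) (F : T -> V -> Prop) :
  (forall x, semilinear (F x)) -> semilinear (fun v => exists2 x, x \in r & F x v).
Proof.
move=> Fs; elim: r => [|x r IHr].
  by apply: eq_semilinear semilinear0 => v; split=> // -[].
apply: eq_semilinear (semilinearU (Fs x) IHr) => v; split.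
  by move=> [Fx|[y yr Fy]]; [exists x|exists y]; rewrite // inE ?eqxx ?yr ?orbT.
by move=> [y]; rewrite inE => /predU1P[->|yr Fy]; [left|right; exists y].
Qed.

Lemma semilinearD A B : semilinear A -> semilinear B ->
  semilinear (fun v => exists x y, [/\ A x, B y & v = x + y]).
Proof.
move=> [L AL] [K BK].
exists [seq (l.1 + k.1, l.2 ++ k.2) | l <- L, k <- K] => v; split.
  move=> [x [y [/AL[l lL [x' x'P ->]] /BK[k kK [y' y'P ->]] ->]]].
  exists (l.1 + k.1, l.2 ++ k.2); first by apply/allpairsPdep; exists l, k.
  by exists (x' + y'); [apply/span_cat; exists x', y'|rewrite addrACA].
move=> [_ /allpairsPdep[l [k [lL kK ->]]] [w /span_cat[x [y [xP yP ->]]] ->]].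
exists (l.1 + x), (k.1 + y); split; last by rewrite addrACA.
  by apply/AL; exists l => //; exists x.
by apply/BK; exists k => //; exists y.
Qed.

(** In a nonempty sum of elements of c + span ps, one c is singled out and the others become
    periods. Conversely, the whole span part can be attached to a single summand. *)
Lemma star_linear l v :
  star (linear_set l) v <-> v = 0 \/ linear_set (l.1, l.1 :: l.2) v.
Proof.
case: l => c ps /=; split=> [[ks ksP ->]|[->|[w /span_cons[n [u [uP ->]]] ->]]].
- elim: ks ksP => [|k ks IHks] ksP; first by rewrite big_nil; left.
  right; rewrite big_cons.
  have [u uP ->] := ksP k (mem_head _ _).
  have uP' : span (c :: ps) u by apply: sub_span uP => x xps; rewrite inE xps orbT.
  case: IHks => [x xks|->|[w wP ->]]; first by apply: ksP; rewrite inE xks orbT.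
    by exists u; rewrite ?addr0.
  exists (u + (c + w)); last by rewrite -addrA.
  by do 2?apply: spanD => //; apply/span_gen/mem_head.
- by exists [::]; rewrite ?big_nil.
- exists ((c + u) :: nseq n c); last by rewrite big_cons big_nseq iter_addr_0 -addrA [u + _]addrC.
  move=> k; rewrite inE => /predU1P[->|/nseqP[-> _]]; first by exists u.
  by exists 0; [exact: span0|rewrite addr0].
Qed.

(** By commutativity, the star of a union is the sum of the stars. *)
Lemma star_semilinear A : semilinear A -> semilinear (star A).
Proof.
case=> L AL; suff: semilinear (star (fun v => exists2 l, l \in L & linear_set l v)).
  apply: eq_semilinear => v; split=> -[ks ksP ->]; exists ks => // k /ksP/AL//.
elim: L {A AL} => [|l L IHL].
  apply: eq_semilinear (semilinear1 0) => v; split=> [<-|[ks ksP ->]].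
    by exists [::]; rewrite ?big_nil.
  by case: ks ksP => [|k ks /(_ k (mem_head _ _))[]//]; rewrite big_nil.
have ls : semilinear (star (linear_set l)).
  apply: (eq_semilinear (A := fun v => 0 = v \/ exists2 k,
      k \in [:: (l.1, l.1 :: l.2)] & linear_set k v)).
    move=> v; rewrite star_linear; split; case=> [->|].
    - by left.
    - by move=> [k]; rewrite inE => /eqP->; right.
    - by left.
    - by move=> lv; right; exists (l.1, l.1 :: l.2); rewrite ?mem_head.
  by apply: semilinearU (semilinear1 0) _; exists [:: (l.1, l.1 :: l.2)].
apply: eq_semilinear (semilinearD ls IHL) => v; split.
  move=> [x [y [[ks ksP ->] [js jsP ->] ->]]]; exists (ks ++ js); last by rewrite big_cat.
  move=> k; rewrite mem_cat => /orP[/ksP lk|/jsP[j jL jk]].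
    by exists l; rewrite ?mem_head.
  by exists j; rewrite // inE jL orbT.
move=> [ks ksP ->].
exists (\sum_(k <- ks | `[< linear_set l k >]) k), (\sum_(k <- ks | ~~ `[< linear_set l k >]) k).
split; last exact: bigID.
  rewrite -big_filter; exists [seq k <- ks | `[< linear_set l k >]] => // k.
  by rewrite mem_filter => /andP[/asboolP].
rewrite -big_filter; exists [seq k <- ks | ~~ `[< linear_set l k >]] => // k.
rewrite mem_filter => /andP[/asboolPn lk /ksP[j]].
by rewrite inE => /predU1P[->//|jL jk]; exists j.
Qed.

End Semilinear.

(* Parikh's theorem for automata with labels in a commutative monoid, by Kleene's
   induction on the set X of states allowed inside a path. *)
Section Parikh.
Variables (V : nmodType) (S : finType) (E : seq (S * V * S)).

Inductive path_sum (X : pred S) : S -> S -> V -> Prop :=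
  | PathEdge s v t : (s, v, t) \in E -> path_sum X s t v
  | PathCons s v u w t : (s, v, u) \in E -> X u -> path_sum X u t w ->
      path_sum X s t (v + w).

Lemma path_sum_sub (X Y : pred S) s t v :
  (forall u, X u -> Y u) -> path_sum X s t v -> path_sum Y s t v.
Proof.
move=> XY; elim=> {s t v} [s v t e|s v u w t e Xu _ IH]; first exact: PathEdge.
by apply: PathCons e _ IH; apply: XY.
Qed.

Lemma path_sum_cat (X : pred S) s u t v w :
  path_sum X s u v -> X u -> path_sum X u t w -> path_sum X s t (v + w).
Proof.
elim=> {s u v} [s v u e Xu|s v u v' u' e Xu _ IH Xu'] p; first exact: PathCons e _ p.
by rewrite -addrA; apply: PathCons e Xu _; apply: IH.
Qed.

(** The path is cut at its inner visits to x; the middle pieces are loops at x with inner states in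
    [X]. *)
Lemma path_sum_via (X : pred S) (x : S) s t v :
  path_sum (predU (pred1 x) X) s t v <->
  path_sum X s t v \/ exists a b c,
    [/\ path_sum X s x a, star (path_sum X x x) b, path_sum X x t c & v = a + (b + c)].
Proof.

split=> [|[|[a [b [c [sa [ks xx ->] ct ->]]]]]].
- elim=> {s t v} [s v t e|s v u w t e /orP[/eqP ux|Xu] _ IH].
  + by left; apply: PathEdge.
  + right; rewrite ux in e IH; exists v.
    case: IH => [xt|[a [b [c [xa [ks xx ->] ct ->]]]]].
      exists 0, w; rewrite add0r; split=> //; first exact: PathEdge.
      by exists [::]; rewrite ?big_nil.
    exists (a + \sum_(k <- ks) k), c; rewrite -addrA; split=> //; first exact: PathEdge.
    exists (a :: ks); last by rewrite big_cons.
    by move=> k; rewrite inE => /predU1P[->|/xx].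
  + case: IH => [ut|[a [b [c [xa xx ct ->]]]]]; first by left; apply: PathCons e Xu ut.
    right; exists (v + a), b, c; rewrite -addrA; split=> //.
    exact: PathCons e Xu xa.
- by apply: path_sum_sub => u /= ->; rewrite orbT.
have sub u u' v' : path_sum X u u' v' -> path_sum (predU (pred1 x) X) u u' v'.
  by apply: path_sum_sub => y /= ->; rewrite orbT.
have Xx : predU (pred1 x) X x by rewrite /= eqxx.
apply: (path_sum_cat (sub _ _ _ sa) Xx) => {a sa}.
elim: ks xx => [|k ks IHks] xx; first by rewrite big_nil add0r; apply: sub.
rewrite big_cons -addrA; apply: (path_sum_cat (sub _ _ _ (xx _ (mem_head _ _))) Xx).
by apply: IHks => j jks; apply: xx; rewrite inE jks orbT.
Qed.

Lemma path_sum_semilinear s t : semilinear (path_sum predT s t).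
Proof.
suff H (r : seq S) : forall s t, semilinear (path_sum (mem r) s t).
  apply: eq_semilinear (H (enum S) s t) => v.
  by split; apply: path_sum_sub => u _ //=; rewrite mem_enum.
elim: r => [|x r IHr] {}s {}t.
  apply: (eq_semilinear (A := fun v => exists2 e, e \in E &
      (e.1.1 == s) && (e.2 == t) /\ e.1.2 = v)).
    move=> v; split=> [[[[s' c] t'] eE /= [/andP[/eqP<- /eqP<-] <-]]|].
      exact: PathEdge.
    by case=> {s t v} [s v t e|//]; exists (s, v, t); rewrite ?eqxx.
  apply: semilinear_in => e; case: (_ && _).
    by apply: eq_semilinear (semilinear1 e.1.2) => v; split=> [|[]].
  by apply: eq_semilinear (@semilinear0 V) => v; split=> // -[].
apply: (eq_semilinear (A := path_sum (predU (pred1 x) (mem r)) s t)).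
  by move=> v; split; apply: path_sum_sub => u; rewrite /= inE.
apply: eq_semilinear (semilinearU (IHr s t) (semilinearD (IHr s x)
  (semilinearD (star_semilinear (IHr x x)) (IHr x t)))) => v.
rewrite path_sum_via; split=> [[|H]|[|H]]; [by left|right|by left|right].
  by case: H => a [_ [sa [b [c [xx xt ->]]] ->]]; exists a, b, c.
by case: H => a [b [c [sa xx xt ->]]]; exists a, (b + c); split=> //; exists b, c.
Qed.

End Parikh.

(** Let N bound f on a basis B0 for the remaining functions. An element with f s >= N lies above a
    member of B0; each of the finitely many smaller values of f gets a basis of its own. Arbitrary
    functions are allowed so that coordinates, forms and residues can be compared together. *)
Lemma dickson (T : eqType) (fs : seq (T -> nat)) (S : T -> Prop) :
  exists2 B : seq T, (forall b, b \in B -> S b) &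
    forall s, S s -> exists2 b, b \in B & all (fun f => f b <= f s)%N fs.
Proof.
elim: fs S => [|f fs IHfs] S.
  have [[s Ss]|nS] := pselect (exists s, S s).
    exists [:: s] => [b|s' _]; first by rewrite inE => /eqP->.
    by exists s; rewrite ?mem_head.
  by exists [::] => // s Ss; case: nS; exists s.
have [B0 B0S B0P] := IHfs S; pose N := (\max_(b <- B0) f b)%N.
have /choice[B BP] (i : nat) : exists B : seq T,
    (forall b, b \in B -> S b /\ f b = i) /\
    forall s, S s /\ f s = i -> exists2 b, b \in B & all (fun f => f b <= f s)%N fs.
  by have [B ? ?] := IHfs (fun s => S s /\ f s = i); exists B.
exists (B0 ++ flatten [seq B i | i <- iota 0 N]) => [b|s Ss].
  rewrite mem_cat => /orP[/B0S//|/flatten_mapP[i _ bB]].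
  by have [/(_ b bB)[]] := BP i.
have [sN|Ns] := ltnP (f s) N.
  have [bP /(_ s)[//|b bB bs]] := BP (f s); exists b; last by rewrite /= bs (bP b bB).2 leqnn.
  by rewrite mem_cat; apply/orP; right; apply/flatten_mapP; exists (f s); rewrite ?mem_iota.
have [b bB bs] := B0P s Ss; exists b; first by rewrite mem_cat bB.
by rewrite /= bs andbT (leq_trans _ Ns) // /N (big_rem _ bB) leq_maxl.
Qed.

(** * Semilinear and Presburger sets of integer vectors *)

Section IntegerSemilinear.
Variable I : finType.
Implicit Types (v w : I -> int) (P : (I -> int) -> Prop).

(** The coefficient of each generator becomes a quantified variable. *)
Lemma span_presburger (ps : seq (I -> int)) : presburger (span ps).
Proof.
elim: ps => [|p ps IHps].
  apply: (eq_presburger (P := fun e => forall i, e i = 0)).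
    move=> e; split=> [e0|[ks ksP ->] i].
      by rewrite (_ : e = 0); [exact: span0|apply/funext].
    by case: ks ksP => [|k ks /(_ k (mem_head _ _))//]; rewrite big_nil.
  apply: presburger_forall_fin => i.
  by apply: presburger_eq; [apply: affine_var|apply: affine_const].
apply: (eq_presburger (P := fun e => exists x, 0 <= x /\ span ps (fun i => e i - x * p i))).
  move=> e; rewrite span_cons; split=> [[x [x_ge0 xP]]|[n [w [wP ->]]]].
    exists `|x|%N; exists (fun i => e i - x * p i); split=> //.
    by apply/funext => i; rewrite !fctE natmulfctE -mulr_natr natz; nia.
  exists n%:Z; split=> //; congr (span ps _): wP; apply/funext => i.
  by rewrite !fctE natmulfctE -mulr_natr natz; nia.
apply: presburger_ex; apply: presburger_and.
  by apply: presburger_le; [apply: affine_const|apply: affine_var].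
apply: (presburger_comp (h := fun i (e : option I -> int) => e (Some i) - e None * p i)) => // i.
by apply: affineB; [|apply: affineZr]; apply: affine_var.
Qed.

Lemma semilinear_presburger (A : (I -> int) -> Prop) : semilinear A -> presburger A.
Proof.
case=> L AL; apply: eq_presburger (presburger_in L (P := @linear_set _) _) => [v|l].
  by rewrite AL.
apply: (eq_presburger (P := fun e => span l.2 (fun i => e i - l.1 i))).
  move=> e; split=> [lP|[w wP ->]].
    exists (fun i => e i - l.1 i) => //; apply/funext => i; rewrite !fctE; ring.
  by congr (span _ _): wP; apply/funext => i; rewrite !fctE; ring.
apply: (presburger_comp (h := fun i e => e i - l.1 i) (span_presburger l.2)) => i.
by apply: affineB; [apply: affine_var|apply: affine_const].
Qed.

Definition nonneg v := forall i, 0 <= v i.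

Definition coord_keys : seq ((I -> int) -> nat) := [seq (fun v => `|v i|%N) | i <- enum I].

Lemma coord_keysP v w : nonneg v -> nonneg w ->
  all (fun f => f v <= f w)%N coord_keys -> nonneg (w - v).
Proof.
move=> v_ge0 w_ge0 /allP vw i.
have /vw : (fun v => `|v i|%N) \in coord_keys by apply: map_f; rewrite mem_enum.
by rewrite !fctE /=; have := v_ge0 i; have := w_ge0 i; lia.
Qed.

(* By Dickson's lemma, finitely many nonzero elements of H are minimal for the
   keys; subtracting one of them from an element of H makes it smaller. *)
Lemma span_of_subtractive (H : (I -> int) -> Prop) (fs : seq ((I -> int) -> nat)) :
  (forall v, H v -> nonneg v) -> H 0 -> (forall v w, H v -> H w -> H (v + w)) ->
  (forall v w, H v -> H w -> all (fun f => f v <= f w)%N (coord_keys ++ fs) -> H (w - v)) ->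
  exists2 B : seq (I -> int), (forall b, b \in B -> nonneg b) & forall v, H v <-> span B v.
Proof.
move=> H_ge0 H0 HD HB.
have [B BH BP] := dickson (coord_keys ++ fs) (fun v => H v /\ v <> 0).
exists B => [b /BH[/H_ge0]//|v]; split; last first.
  by case=> ks ksP ->; rewrite big_seq; elim/big_ind: _ => // k /ksP/BH[].
move: {2}(\sum_i `|v i|%N)%N (leqnn (\sum_i `|v i|%N)%N) => n.
elim: n v => [|n IHn] v vn Hv; have [->|v0] := pselect (v = 0); do ?exact: span0.
  case: v0; apply/funext => i; move: vn; rewrite leqn0 sum_nat_eq0 => /forallP/(_ i).
  by rewrite /= absz_eq0 => /eqP.
have [b bB bv] := BP v (conj Hv v0); have [Hb b0] := BH b bB.
have /IHn -/(_ _)[|ks ksP vE] := HB b v Hb Hv bv; last first.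
  rewrite -[v](subrK b); apply: spanD (span_gen bB).
  by exists ks.
have := bv; rewrite all_cat => /andP[/(coord_keysP (H_ge0 _ Hb) (H_ge0 _ Hv)) vb_ge0 _].
have [i bi] : exists i, b i != 0.
  apply: contrapT => nb; apply: b0; apply/funext => i; apply/eqP/negP => bi.
  by apply: nb; exists i; apply/negP.
rewrite -ltnS (leq_trans _ vn) //.
rewrite (bigD1 i) //= [ltnRHS](bigD1 i) //= -addSn leq_add //.
  by have := vb_ge0 i; have := H_ge0 _ Hb i; rewrite !fctE; move: bi; lia.
apply: leq_sum => j _; have := vb_ge0 j; have := H_ge0 _ Hb j; rewrite !fctE; lia.
Qed.

Section Conjunction.
Variable C : seq (atom I).

(** Keys whose growth from v to w makes the homogeneous atom hold for w - v. For a modulus b, the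
    residue r and b - r can both grow weakly only if the residues agree. *)
Definition atom_keys (t : atom I) : seq ((I -> int) -> nat) :=
  let: (u, a, b) := t in
  if b == 0%N then [:: fun v => `|form_eval u a v|%N]
  else [:: fun v => `|(form_eval u a v %% b%:Z)%Z|%N;
           fun v => (b - `|(form_eval u a v %% b%:Z)%Z|)%N].

Definition hom_holds (v : I -> int) (t : atom I) : bool :=
  let: (u, a, b) := t in
  if b == 0%N then 0 <= form_eval u 0 v else (b%:Z %| form_eval u 0 v)%Z.

(** The recession monoid: the directions that can be added to any nonnegative solution of [C]. *)
Definition conj_dirs v := nonneg v /\ all (hom_holds v) C.

Lemma form_evalB u a v w : form_eval u a w - form_eval u a v = form_eval u 0 (w - v).
Proof.
rewrite /form_eval addr0 opprD addrACA subrr addr0 -sumrB.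
by apply: eq_bigr => i _; rewrite fctE mulrBr.
Qed.

Lemma atom_keys_hom v w t :
  (t.2 = 0%N -> 0 <= form_eval t.1.1 t.1.2 v /\ 0 <= form_eval t.1.1 t.1.2 w) ->
  all (fun f => f v <= f w)%N (atom_keys t) -> hom_holds (w - v) t.
Proof.
case: t => [[u a] b] /=; case: eqP => [-> /(_ erefl)[v_ge0 w_ge0]|/eqP b0 _] /=.
  by rewrite andbT -(form_evalB _ a); lia.
rewrite andbT -(form_evalB _ a) -eqz_mod_dvd.
have bz : b%:Z != 0 by lia.
have := modz_ge0 (form_eval u a v) bz; have := modz_ge0 (form_eval u a w) bz.
have := ltz_mod (form_eval u a v) bz; have := ltz_mod (form_eval u a w) bz.
lia.
Qed.

Lemma form_evalD u a v w : form_eval u a (v + w) = form_eval u a v + form_eval u 0 w.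
Proof.
rewrite /form_eval addr0 addrAC -big_split /=; congr (_ + _).
by apply: eq_bigr => i _; rewrite fctE mulrDr.
Qed.

Lemma conj_dirsD v w : conj_dirs v -> conj_dirs w -> conj_dirs (v + w).
Proof.
move=> [v_ge0 /allP vC] [w_ge0 /allP wC]; split=> [i|].
  by rewrite fctE; apply: addr_ge0.
apply/allP => t tC; have := vC t tC; have := wC t tC.
case: t {tC} => [[u a] b] /=; rewrite form_evalD; case: ifP => _ wt vt.
  exact: addr_ge0.
exact: rpredD.
Qed.

Lemma conj_dirs0 : conj_dirs 0.
Proof.
split=> //; apply/allP => -[[u a] b] _ /=; rewrite /form_eval big1 ?addr0.
  by case: ifP => // _; apply: rpred0.
by move=> i _; rewrite mulr0.
Qed.

(** With constants 0 the keys control exactly the homogeneous atoms, so a direction may be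
    subtracted from any direction above it in all keys. *)
Lemma conj_dirs_span :
  exists2 B : seq (I -> int), (forall b, b \in B -> nonneg b) &
    forall v, conj_dirs v <-> span B v.
Proof.
apply: (span_of_subtractive (fs := flatten
    [seq atom_keys (t.1.1, 0, t.2) | t <- C])) => [v []//||v w|v w].
- exact: conj_dirs0.
- exact: conj_dirsD.
move=> [v_ge0 /allP vC] [w_ge0 /allP wC]; rewrite all_cat => /andP[vw /allP vwC].
split; first exact: coord_keysP.
apply/allP => t tC; have := vC t tC; have := wC t tC.
have -> : hom_holds (w - v) t = hom_holds (w - v) (t.1.1, 0, t.2) by case: t {tC} => [[]].
move=> wt vt; apply: atom_keys_hom => /= [t2|].
  by move: wt vt; case: t t2 {tC} => [[u a] b] /= ->.
apply/allP => f fT; apply: vwC; apply/flatten_mapP; by exists t.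
Qed.

End Conjunction.

(** For one conjunction, a solution above another one in all keys differs from it by a direction;
    hence the solutions are a Dickson basis plus the span of the directions. *)
Lemma nonneg_presburger_semilinear P :
  presburger P -> (forall v, P v -> nonneg v) ->
  exists2 L : seq ((I -> int) * seq (I -> int)),
    (forall l, l \in L -> nonneg l.1 /\ forall p, p \in l.2 -> nonneg p) &
    forall v, P v <-> exists2 l, l \in L & linear_set l v.
Proof.
move=> [F PE] P_ge0.
pose S C v := nonneg v /\ all (atom_holds v) C.
have {PE P_ge0} PE v : P v <-> exists2 C, C \in F & S C v.
  split=> [Pv|[C CF [_ Cv]]]; last by rewrite PE; apply/hasP; exists C.
  have v_ge0 := P_ge0 v Pv; move: Pv; rewrite PE => /hasP[C CF Cv].
  by exists C.
suff: forall C, exists2 L : seq ((I -> int) * seq (I -> int)),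
    (forall l, l \in L -> nonneg l.1 /\ forall p, p \in l.2 -> nonneg p) &
    forall v, S C v <-> exists2 l, l \in L & linear_set l v.
  move=> SL; elim: F P PE => [|C F IHF] P PE.
    by exists [::] => // v; rewrite PE; split=> -[].
  have [K K_ge0 KE] := IHF _ (fun v => iff_refl _); have [L L_ge0 LE] := SL C.
  exists (L ++ K) => [l|v]; first by rewrite mem_cat => /orP[/L_ge0|/K_ge0].
  rewrite PE; split=> [[C']|[l]].
    rewrite inE => /predU1P[->|C'F Sv].
      by move=> /LE[l lL lv]; exists l; rewrite // mem_cat lL.
    have /KE[l lK lv] : exists2 C, C \in F & S C v by exists C'.
    by exists l; rewrite // mem_cat lK orbT.
  rewrite mem_cat => /orP[lL|lK] lv.
    by exists C; rewrite ?mem_head //; apply/LE; exists l.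
  have /KE[C' C'F C'v] : exists2 l, l \in K & linear_set l v by exists l.
  by exists C'; rewrite // inE C'F orbT.
move=> C; have [ds ds_ge0 dsE] := conj_dirs_span C.
have [B BS BP] := dickson (coord_keys ++ flatten [seq atom_keys t | t <- C]) (S C).
exists [seq (b, ds) | b <- B] => [_ /mapP[b /BS[b_ge0 _] ->]//|v].
split=> [Sv|[_ /mapP[b /BS[b_ge0 /allP bC] ->] [w /dsE[w_ge0 /allP wC] ->]]].
  have [b bB] := BP v Sv; have [b_ge0 /allP bC] := BS b bB.
  case: Sv => v_ge0 /allP vC; rewrite all_cat => /andP[bv /allP bvC].
  exists (b, ds); first exact: map_f.
  exists (v - b); last by rewrite /= subrKC.
  apply/dsE; split; first exact: coord_keysP.
  apply/allP => t tC; apply: atom_keys_hom.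
    have := bC t tC; have := vC t tC.
    by case: t {tC} => [[u a] b'] /= vt bt b0; rewrite b0 /= in vt bt; rewrite !ltW.
  by apply/allP => f ft; apply: bvC; apply/flatten_mapP; exists t.
split=> [i|]; first by rewrite /= fctE; apply: addr_ge0.
apply/allP => t tC; have := bC t tC; have := wC t tC.
case: t {tC} => [[u a] c] /=; rewrite form_evalD; case: ifP => _ wt bt.
  exact: ltr_pwDl.
exact: rpredD.
Qed.

End IntegerSemilinear.

(* A subgroup K of Z^I is the image of the submonoid {(v, w) | v - w in K} of
   N^(I + I), which is closed under subtraction. *)
Lemma subgroup_presburger (I : finType) (K : (I -> int) -> Prop) :
  K 0 -> (forall v w, K v -> K w -> K (v - w)) -> presburger K.
Proof.
move=> K0 KB; have KD v w : K v -> K w -> K (v + w).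
  by move=> Kv Kw; rewrite -[w]opprK; apply: (KB) => //; rewrite -sub0r; apply: (KB).
pose diff (e : I + I -> int) : I -> int := fun i => e (inl i) - e (inr i).
have [||||B B_ge0 BE] := @span_of_subtractive _ (fun e => nonneg e /\ K (diff e)) [::].
- by move=> v [].
- by split=> //; rewrite (_ : diff 0 = 0) //; apply/funext => i; rewrite /diff !fctE subr0.
- move=> v w [v_ge0 Kv] [w_ge0 Kw]; split=> [s|]; first by rewrite fctE addr_ge0.
  rewrite (_ : diff _ = diff v + diff w); first exact: KD.
  by apply/funext => i; rewrite /diff !fctE; ring.
- move=> v w [v_ge0 Kv] [w_ge0 Kw]; rewrite cats0 => vw; split; first exact: coord_keysP.
  rewrite (_ : diff _ = diff w - diff v); first exact: KB.
  by apply/funext => i; rewrite /diff !fctE; ring.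
apply: (eq_presburger (P := fun e => exists w, span B w /\ forall i, e i = diff w i)).
  move=> e; split=> [[w [/BE[_ Kw] ew]]|Ke]; first by rewrite (_ : e = diff w) //; apply/funext.
  exists (fun s => if s is inl i then Num.max (e i) 0
                   else if s is inr i then Num.max (- e i) 0 else 0).
  have eE i : e i = Num.max (e i) 0 - Num.max (- e i) 0 by lia.
  split; last exact: eE.
  apply/BE; split; last by rewrite (_ : diff _ = e) //; apply/funext => i; rewrite /diff -eE.
  by case=> i; rewrite le_max lexx orbT.
apply: (presburger_exists (P := fun w e => span B w /\ forall i, e i = diff w i)).
apply: presburger_and.
  apply: (presburger_comp (h := fun s e => e (inr s)) (span_presburger B)) => s.
  exact: affine_var.
apply: presburger_forall_fin => i; apply: presburger_eq; first exact: affine_var.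
by apply: affineB; apply: affine_var.
Qed.

Local Open Scope classical_set_scope.
Local Open Scope ring_scope.
Local Open Scope group_scope.

(** * Presburger interpretation of virtually abelian groups *)

Lemma additive_affine (k : nat) (h : ('I_k -> int) -> int) :
  {morph h : v w / (v + w)%R} -> affine h.
Proof.
move=> hD; have h0 : h 0%R = 0%R by apply: (addIr (h 0%R)); rewrite -hD !add0r.
have hN v : h (- v)%R = (- h v)%R by apply: (addIr (h v)); rewrite -hD !addNr.
have hM v (n : nat) : h (v *+ n)%R = (h v *+ n)%R.
  by elim: n => [|n IHn]; rewrite ?mulr0n // !mulrS hD IHn.
have hZ v (n : int) : h (v *~ n)%R = (n * h v)%R.
  case: n => n.
    by rewrite -pmulrn hM -mulr_natl natz.
  by rewrite NegzE -nmulrn hN hM -mulr_natl natz mulNr.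
pose delta (i : 'I_k) : 'I_k -> int := fun j => (j == i)%:Z.
exists (fun i => h (delta i)), 0%R => e; rewrite addr0.
rewrite {1}(_ : e = \sum_i delta i *~ e i)%R.
  by rewrite (big_morph h hD h0); apply: eq_bigr => i _; rewrite hZ mulrC.
have mulz (f : 'I_k -> int) (n : int) j : (f *~ n)%R j = (f j * n)%R.
  by case: n => n; rewrite ?NegzE -?nmulrn -?pmulrn ?opprfctE natmulfctE -mulr_natr natz ?mulrN.
apply/funext => j; rewrite fct_sumE (bigD1 j) //= mulz /delta eqxx mul1r big1 ?addr0 // => i.
by rewrite mulz eq_sym => /negbTE->; rewrite mul0r.
Qed.

(** Kept apart from [setting], so that words over one group can be evaluated in the coordinates of
    another, as for the projections of G^q to G. *)
Record coords (G : groupType) (k d : nat) := Coords {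
  emb : ('I_k -> int) -> G;
  rep : 'I_d -> G;
  emb_inj : injective emb;
  embD : {morph emb : v w / (v + w)%R >-> v * w};
  emb_norm : forall g v, exists w, g * emb v = emb w * g;
  emb_cover : forall g, exists t v, g = emb v * rep t;
  rep_uniq : forall s t v w, emb v * rep s = emb w * rep t -> s = t }.

Lemma subgroup1 (G : groupType) (V : set G) : subgroup V -> V 1.
Proof. by case=> /set_mem. Qed.

Lemma subgroupF (G : groupType) (V : set G) x y :
  subgroup V -> V x -> V y -> V (x / y).
Proof. by case=> _ VF Vx Vy; apply/set_mem/VF; apply/mem_set. Qed.

Lemma subgroupV (G : groupType) (V : set G) x : subgroup V -> V x -> V x^-1.
Proof. by move=> Vs Vx; rewrite -div1g; apply: subgroupF => //; apply: subgroup1. Qed.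

Lemma subgroupM (G : groupType) (V : set G) x y :
  subgroup V -> V x -> V y -> V (x * y).
Proof.
by move=> Vs Vx Vy; rewrite -[y]invgK; apply: subgroupF => //; apply: subgroupV.
Qed.

Section Interpretation.
Variables (G : groupType) (k d : nat) (C : coords G k d).
Local Notation vec := ('I_k -> int).
Local Notation emb := (emb C).
Local Notation rep := (rep C).

Lemma emb0 : emb 0%R = 1.
Proof. by apply: (mulgI (emb 0%R)); rewrite -embD addr0 mulg1. Qed.

Lemma embN v : emb (- v)%R = (emb v)^-1.
Proof. by apply: (mulgI (emb v)); rewrite -embD subrr emb0 mulgV. Qed.

(** Conjugation by g is additive on Z^k, hence linear in coordinates; this is what makes
    multiplication affine. *)
Lemma emb_conj (g : G) : exists2 c : 'I_k -> vec -> int,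
  (forall i, affine (c i)) & forall v, g * emb v = emb (fun i => c i v) * g.
Proof.
have /choice[c cE] := emb_norm C g.
exists (fun i v => c v i) => // i; apply: additive_affine => v w.
have -> : c (v + w)%R = (c v + c w)%R; last by rewrite fctE.
apply: (@emb_inj _ _ _ C); apply: (mulIg g).
by rewrite -cE !embD -mulgA -cE !mulgA cE.
Qed.

Section GroupValued.
Variable I : finType.
Implicit Types (F : (I -> int) -> G) (P : (I -> int) -> G -> Prop).

(** Such a map stays in one coset of the lattice. A power g^n with variable n need not, which is why
    the wider [definable_map] is introduced. *)
Definition affine_group F := exists (L : 'I_k -> (I -> int) -> int) (g : G),
  (forall i, affine (L i)) /\ forall e, F e = emb (fun i => L i e) * g.

Lemma affine_group_const (g : G) : affine_group (fun=> g).
Proof.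
exists (fun i _ => 0%R), g; split=> [i|e]; first exact: affine_const.
by rewrite (_ : (fun=> _) = 0%R) ?emb0 ?mul1g.
Qed.

Lemma affine_groupM F F' :
  affine_group F -> affine_group F' -> affine_group (fun e => F e * F' e).
Proof.
move=> [L [g [LA FE]]] [L' [g' [LA' FE']]].
have [c cA cE] := emb_conj g.
exists (fun i e => L i e + c i (fun j => L' j e))%R, (g * g').
split=> [i|e]; first by apply: affineD => //; apply: affine_comp.
rewrite FE FE' -mulgA (mulgA g) cE !mulgA -embD.
by congr (emb _ * g * g'); apply/funext.
Qed.

Lemma affine_groupV F : affine_group F -> affine_group (fun e => (F e)^-1).
Proof.
move=> [L [g [LA FE]]]; have [c cA cE] := emb_conj g^-1.
exists (fun i e => c i (fun j => - L j e)%R), g^-1; split=> [i|e].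
  by apply: affine_comp => // j; apply: affineN.
by rewrite FE invgM -embN -cE.
Qed.

Lemma affine_group_emb (L : 'I_k -> (I -> int) -> int) g :
  (forall i, affine (L i)) -> affine_group (fun e => emb (fun i => L i e) * g).
Proof. by move=> LA; exists L, g. Qed.

(** Equality forces g' / g into the lattice; if it is [emb c], the coordinates are compared up to
    the shift c. *)
Lemma affine_group_eq F F' : affine_group F -> affine_group F' ->
  presburger (fun e => F e = F' e).
Proof.
move=> [L [g [LA FE]]] [L' [g' [LA' FE']]].
have [[c cE]|nc] := pselect (exists c, emb c = g' / g); last first.
  apply: eq_presburger (presburger_false _) => e; split=> //; rewrite FE FE' => eqF.
  apply: nc; exists ((fun i => L i e) - (fun i => L' i e))%R.
  rewrite addrC embD embN; apply: (mulgI (emb (fun i => L' i e))).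
  by rewrite mulVKg mulgA -eqF mulgK.
apply: (eq_presburger (P := fun e => forall i, L i e = (L' i e + c i)%R)).
  move=> e; rewrite FE FE'; split=> [eqL|].
    rewrite (_ : (fun i => L i e) = ((fun i => L' i e) + c)%R); last exact/funext.
    by rewrite embD cE -mulgA mulgVK.
  move=> eqF i; have : emb (fun i => L i e) = emb ((fun i => L' i e) + c)%R.
    by apply: (mulIg g); rewrite eqF embD cE -mulgA mulgVK.
  by move/emb_inj => /(congr1 (fun v => v i)).
apply: presburger_forall_fin => i; apply: presburger_eq => //.
by apply: affineD => //; apply: affine_const.
Qed.

(* The coset and the coordinates of [F e] are definable from [e]. *)
Definition definable_map F := forall t,
  presburger (fun e : I + 'I_k -> int =>
    F (fun i => e (inl i)) = emb (fun j => e (inr j)) * rep t).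

Lemma presburger_ex_group P :
  (forall t, presburger (fun e : I + 'I_k -> int =>
     P (fun i => e (inl i)) (emb (fun j => e (inr j)) * rep t))) ->
  presburger (fun e => exists g, P e g).
Proof.
move=> Ppres; apply: (eq_presburger (P := fun e => exists t w, P e (emb w * rep t))).
  move=> e; split=> [[t [w Pe]]|[g]]; first by exists (emb w * rep t).
  by have [t [w ->]] := emb_cover C g; exists t, w.
apply: presburger_exists_fin => t.
exact: (presburger_exists (P := fun w e => P e (emb w * rep t))).
Qed.

(** The value of F is named by a quantified element, so P is only needed at elements whose coset is
    fixed. *)
Lemma presburger_subst P F : definable_map F ->
  (forall t, presburger (fun e : I + 'I_k -> int =>
     P (fun i => e (inl i)) (emb (fun j => e (inr j)) * rep t))) ->
  presburger (fun e => P e (F e)).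
Proof.
move=> FD Ppres; apply: (eq_presburger (P := fun e => exists g, F e = g /\ P e g)).
  by move=> e; split=> [[g [-> //]]|Pe]; exists (F e).
by apply: presburger_ex_group => t; apply: presburger_and.
Qed.

End GroupValued.

Lemma affine_group_comp (I J : finType) (F : (I -> int) -> G) (h : I -> (J -> int) -> int) :
  affine_group F -> (forall i, affine (h i)) ->
  affine_group (fun e => F (fun i => h i e)).
Proof.
move=> [L [g [LA FE]]] hA; exists (fun i e => L i (fun j => h j e)), g.
by split=> [i|e]; [apply: affine_comp|rewrite FE].
Qed.

Lemma definable_map_comp (I J : finType) (F : (I -> int) -> G) (h : I -> (J -> int) -> int) :
  definable_map F -> (forall i, affine (h i)) ->
  definable_map (fun e => F (fun i => h i e)).
Proof.
move=> FD hA t; apply: (presburger_comp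
  (h := fun s (e : J + 'I_k -> int) => match s with
        | inl i => h i (fun j => e (inl j)) | inr j => e (inr j) end) (FD t)).
case=> [i|j]; last exact: affine_var.
by apply: affine_comp => // j; apply: affine_var.
Qed.

Lemma definable_map_inl (I : finType) (F : (I -> int) -> G) :
  definable_map F -> definable_map (fun e : I + 'I_k -> int => F (fun i => e (inl i))).
Proof. by move=> FD; apply: (definable_map_comp FD) => i; apply: affine_var. Qed.

Lemma affine_group_inr (I : finType) t :
  affine_group (fun e : I + 'I_k -> int => emb (fun j => e (inr j)) * rep t).
Proof. by apply: affine_group_emb => i; apply: affine_var. Qed.

Lemma affine_group_inl (I : finType) (F : (I -> int) -> G) :
  affine_group F -> affine_group (fun e : I + 'I_k -> int => F (fun i => e (inl i))).
Proof. by move=> FD; apply: (affine_group_comp FD) => i; apply: affine_var. Qed.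

Lemma affine_definable (I : finType) (F : (I -> int) -> G) :
  affine_group F -> definable_map F.
Proof.
by move=> FA t; apply: affine_group_eq; [apply: affine_group_inl|apply: affine_group_inr].
Qed.

Lemma definable_map_const (I : finType) (g : G) : definable_map (fun _ : I -> int => g).
Proof. by apply: affine_definable; apply: affine_group_const. Qed.

Lemma eq_definable_map (I : finType) (F F' : (I -> int) -> G) :
  F =1 F' -> definable_map F -> definable_map F'.
Proof. by move=> FF' FD t; apply: eq_presburger (FD t) => e; rewrite FF'. Qed.

Section Closure.
Variable I : finType.
Implicit Types F : (I -> int) -> G.

Lemma definable_mapM F F' :
  definable_map F -> definable_map F' -> definable_map (fun e => F e * F' e).
Proof.
move=> FD FD' t.
apply: (presburger_subst (P := fun (e : I + 'I_k -> int) g =>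
  g * F' (fun i => e (inl i)) = emb (fun j => e (inr j)) * rep t)
  (definable_map_inl FD)) => s.
apply: (presburger_subst (P := fun (e : I + 'I_k + 'I_k -> int) g =>
  emb (fun j => e (inr j)) * rep s * g = emb (fun j => e (inl (inr j))) * rep t)
  (F := fun e => F' (fun i => e (inl (inl i))))) => [|u].
  apply: (definable_map_inl (F := fun e => F' (fun i => e (inl i)))).
  exact: definable_map_inl FD'.
apply: affine_group_eq; last by apply: affine_group_emb => j; apply: affine_var.
by apply: affine_groupM; apply: affine_group_emb => j; apply: affine_var.
Qed.

Lemma definable_mapV F : definable_map F -> definable_map (fun e => (F e)^-1).
Proof.
move=> FD t.
apply: (presburger_subst (P := fun (e : I + 'I_k -> int) g =>
  g^-1 = emb (fun j => e (inr j)) * rep t) (definable_map_inl FD)) => s.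
apply: affine_group_eq; last by apply: affine_group_emb => j; apply: affine_var.
by apply: affine_groupV; apply: affine_group_emb => j; apply: affine_var.
Qed.

Lemma definable_map_eq F F' : definable_map F -> definable_map F' ->
  presburger (fun e => F e = F' e).
Proof.
move=> FD FD'; apply: (presburger_subst (P := fun e g => g = F' e) FD) => t.
by apply: eq_presburger (FD' t) => e; split.
Qed.

(* A power [c] of [g] lies in the lattice, and [g ^+ n] is affine in [n] on each
   residue class modulo its exponent. *)
Lemma definable_map_expg (g : G) (L : (I -> int) -> int) : affine L ->
  definable_map (fun e => g ^+ `|L e|%N).
Proof.
move=> LA t; have [N [N_gt0 [c cE]]] : exists N, (0 < N)%N /\ exists c, g ^+ N = emb c.
  have /choice[s /choice[z sz]] n := emb_cover C (g ^+ n).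
  (* Two of the d + 1 powers g^0, ..., g^d lie in the same coset. *)
  have /injectivePn[i [j ij sij]] : ~~ injectiveb (fun i : 'I_d.+1 => s i).
    apply/negP => /injectiveP /leq_card; by rewrite !card_ord ltnn.
  wlog ltij : i j ij sij / (i < j)%N.
    move=> H; move: (ij); rewrite neq_ltn => /orP[]; first exact: (H i j).
    by apply: (H j i) => //; rewrite eq_sym.
  exists (j - i)%N; rewrite subn_gt0 ltij; split=> //; exists (z j - z i)%R.
  rewrite expgnFr 1?ltnW // (sz i) (sz j) sij invgM mulgA mulgK -embN -embD.
  by congr emb.
pose L' (e : I + 'I_k -> int) := L (fun i => e (inl i)).
have LA' : affine L' by apply: affine_comp => // i; apply: affine_var.
(* q and r are the quotient and remainder of the absolute value by N; the two signs replace the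
   absolute value. *)
apply: (eq_presburger (P := fun e => exists q, exists r : 'I_N,
  [/\ (0 <= q)%R, (L' e = q * N%:Z + r%:Z \/ L' e = - (q * N%:Z + r%:Z))%R
    & emb (fun i => q * c i)%R * g ^+ r = emb (fun j => e (inr j)) * rep t])).
  have powE (q : nat) r : g ^+ (q * N + r) = emb (fun i => q%:Z * c i)%R * g ^+ r.
    rewrite expgnDr; congr (_ * _); elim: q => [|q IHq].
      by rewrite (_ : (fun=> _) = 0%R) ?emb0 //; apply/funext => i; rewrite mul0r.
    rewrite mulSn expgnDr IHq cE -embD; congr (emb _); apply/funext => i.
    by rewrite !fctE intS mulrDl mul1r.
  move=> e; rewrite -/(L' e); split=> [[q [r [q_ge0 Lqr <-]]]|<-].
    rewrite -[q]gez0_abs // -powE; congr (_ ^+ _); lia.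
  have N0 : N%:Z != 0%R by lia.
  exists (`|L' e| %/ N)%N%:Z, (Ordinal (ltn_pmod `|L' e| N_gt0)) => /=.
  rewrite -powE -divn_eq; split=> //.
  by have := divn_eq `|L' e| N; lia.
apply: presburger_ex; apply: presburger_exists_fin => r.
have L2 : affine (fun e : option (I + 'I_k) -> int => L' (fun i => e (Some i))).
  by apply: affine_comp => // i; apply: affine_var.
have qA : affine (fun e : option (I + 'I_k) -> int => e None * N%:Z + r%:Z)%R.
  by apply: affineD; [apply: affineZr; apply: affine_var|apply: affine_const].
apply: (eq_presburger (P := fun e : option (I + 'I_k) -> int => (0 <= e None)%R /\
  ((L' (fun i => e (Some i)) = e None * N%:Z + r%:Z \/
    L' (fun i => e (Some i)) = - (e None * N%:Z + r%:Z))%R /\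
  emb (fun i => e None * c i)%R * g ^+ r = emb (fun j => e (Some (inr j))) * rep t))).
  by move=> e; split=> [[? []]|[? ?]].
apply: presburger_and.
  by apply: presburger_le; [apply: affine_const|apply: affine_var].
apply: presburger_and.
  by apply: presburger_or; apply: presburger_eq => //; apply: affineN.
apply: affine_group_eq; apply: affine_group_emb => i; last exact: affine_var.
by apply: affineZr; apply: affine_var.
Qed.

End Closure.

Definition definable_set (V : set G) := forall t,
  presburger (fun v : 'I_k -> int => V (emb v * rep t)).

Lemma definable_set_map (V : set G) (I : finType) (F : (I -> int) -> G) :
  definable_set V -> definable_map F -> presburger (fun e => V (F e)).
Proof.
move=> VD FD; apply: (presburger_subst (P := fun e g => V g) FD) => t.
by apply: (presburger_comp (h := fun j e => e (inr j)) (VD t)) => j; apply: affine_var.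
Qed.

(** A nonempty intersection of V with a coset is a translate of the intersection of V with Z^k. *)
Lemma subgroup_definable (V : set G) : subgroup V -> definable_set V.
Proof.
move=> Vs t; have [[v0 Vv0]|nV] := pselect (exists v, V (emb v * rep t)); last first.
  apply: eq_presburger (presburger_false _) => v; split=> // Vv.
  by apply: nV; exists v.
apply: (eq_presburger (P := fun v => V (emb (fun j => v j - v0 j)%R))).
  have embB v : emb (fun j => v j - v0 j)%R = (emb v * rep t) / (emb v0 * rep t).
    by rewrite invgM mulgA mulgK -embN -embD.
  move=> v; rewrite embB; split=> [Vv|Vv]; last exact: subgroupF.
  by have := subgroupM Vs Vv Vv0; rewrite mulgVK.
apply: (presburger_comp (P := fun v => V (emb v)) (h := fun j v => v j - v0 j)%R).
  apply: subgroup_presburger => [|v w Vv Vw]; first by rewrite emb0; apply: subgroup1.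
  by rewrite embD embN; apply: subgroupF.
by move=> j; apply: affineB; [apply: affine_var|apply: affine_const].
Qed.

(** The automaton is multiplied by the set of cosets: in coset t, a letter a leads to the t' with
    rep t * a = emb u * rep t' and contributes the vector u. The vectors are then summed along
    accepting paths. *)
Lemma rational_definable (V : set G) : rational V -> definable_set V.
Proof.
move=> [A [M [_ ->]]] t.
pose S : finType := (dfa_state M * 'I_d)%type.
have /choice[nxt nxtE] (sa : 'I_d * A) : exists us : ('I_k -> int) * 'I_d,
    rep sa.1 * val sa.2 = emb us.1 * rep us.2.
  by have [s [u ->]] := emb_cover C (rep sa.1 * val sa.2); exists (u, s).
(* The representative of the lattice may differ from 1, hence the offset z0. *)
have [t0 [z0 z0E]] := emb_cover C 1.
pose step (x : S) (a : A) : S := (dfa_step x.1 a, (nxt (x.2, a)).2).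
pose label (x : S) (a : A) := (nxt (x.2, a)).1.
pose E := [seq (x, label x a, step x a) | x <- enum S, a <- enum {: A}].
have edgeE x u y : (x, u, y) \in E <-> exists a, u = label x a /\ y = step x a.
  split=> [/allpairsPdep[x' [a [_ _ [-> -> ->]]]]|[a [-> ->]]]; first by exists a.
  by apply/allpairsPdep; exists x, a; rewrite !mem_enum.
have path_word x y u : path_sum E predT x y u ->
    exists w : seq A, foldl step x w = y /\ rep x.2 * value w = emb u * rep y.2.
  elim=> {x y u} [x u y /edgeE[a [-> ->]]|x u y w z /edgeE[a [-> ->]] _ _ [h [<- hE]]].
    by exists [:: a]; rewrite /value big_seq1 (nxtE (x.2, a)).
  by exists (a :: h); rewrite /value big_cons mulgA (nxtE (x.2, a)) -mulgA hE mulgA -embD.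
have word_path a w x : exists u, path_sum E predT x (foldl step x (a :: w)) u /\
    rep x.2 * value (a :: w) = emb u * rep (foldl step x (a :: w)).2.
  elim: w a x => [|b w IHw] a x.
    exists (label x a); rewrite /value big_seq1 (nxtE (x.2, a)); split=> //.
    by apply: PathEdge; apply/edgeE; exists a.
  have [u [pu uE]] := IHw b (step x a); exists (label x a + u)%R; split.
    by apply: PathCons pu => //; apply/edgeE; exists a.
  by rewrite /value big_cons mulgA (nxtE (x.2, a)) -mulgA uE mulgA -embD.
have fold1 x w : (foldl step x w).1 = foldl (@dfa_step _ M) x.1 w.
  by elim: w x => //= a w IHw x; rewrite IHw.
pose x0 : S := (dfa_start M, t0).
(* [path_sum] knows only nonempty paths, so the empty word is a separate disjunct. *)
apply: (eq_presburger (P := fun v => (dfa_start M \in dfa_accept M /\ t0 = t) /\ z0 = v \/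
   exists2 q, q \in enum (dfa_accept M) &
   exists x y, [/\ z0 = x, path_sum E predT x0 (q, t) y & v = x + y]%R)).
  move=> v; split.
    case=> [[[accM <-] <-]|[q qM [_ [y [<- /path_word[w [wq wE]] ->]]]]].
      by rewrite -z0E; exists [::]; rewrite ?/value ?big_nil.
    exists w; first by rewrite /dfa_lang /= -(fold1 x0) wq /=; rewrite mem_enum in qM.
    by rewrite embD -mulgA -[RHS](congr1 _ wE) -[t in rep t]/(x0.2) mulgA -z0E mul1g.
  case=> [[|a w] wM wE].
    left; have := wE; rewrite /value big_nil z0E => vE.
    have t0t := rep_uniq vE; split; first by split.
    by apply: (@emb_inj _ _ _ C); apply: (mulIg (rep t)); rewrite -{1}t0t.
  right; have [u [pu uE]] := word_path a w x0.
  have vE : emb v * rep t = emb (z0 + u)%R * rep (foldl step x0 (a :: w)).2.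
    by rewrite -wE embD -mulgA -uE mulgA -z0E mul1g.
  have tE := rep_uniq vE.
  exists (foldl step x0 (a :: w)).1; first by rewrite mem_enum fold1.
  exists z0, u; split=> //; first by rewrite tE -surjective_pairing.
  by apply: (@emb_inj _ _ _ C); apply: (mulIg (rep t)); rewrite vE -tE.
apply: semilinear_presburger; apply: semilinearU.
  have [p|np] := pselect (dfa_start M \in dfa_accept M /\ t0 = t).
    by apply: eq_semilinear (semilinear1 z0) => v; split=> [|[]].
  by apply: eq_semilinear (@semilinear0 _) => v; split=> // -[].
apply: semilinear_in => q; apply: semilinearD; first exact: semilinear1.
exact: path_sum_semilinear.
Qed.

Lemma geval_definable (I : finType) (X : Type) (F : X -> (I -> int) -> G) (u : gterm X) :
  (forall x, definable_map (F x)) -> definable_map (fun e => geval (fun x => F x e) u).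
Proof.
move=> FD; elim: u => [x||u IHu v IHv|u IHu] /=; first exact: FD.
- exact: definable_map_const.
- exact: definable_mapM.
- exact: definable_mapV.
Qed.

Lemma definable_set_nth (I : finType) (F : (I -> int) -> seq G) i t :
  (forall n, definable_map (fun e => nth 1 (F e) n)) ->
  forall n, definable_map (fun e : I + 'I_k -> int =>
    nth 1 (set_nth 1 (F (fun i => e (inl i))) i (emb (fun j => e (inr j)) * rep t)) n).
Proof.
move=> FD n; have [->|ni] := eqVneq n i.
  apply: eq_definable_map (affine_definable (affine_group_inr I t)) => e.
  by rewrite nth_set_nth /= eqxx.
apply: eq_definable_map (definable_map_inl (FD n)) => e.
by rewrite nth_set_nth /= (negbTE ni).
Qed.

(** A quantifier enlarges [I] by the coordinates of the new element, so the induction runs over all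
    [I] and all environments with definable entries. *)
Lemma gholds_definable (I : finType) (F : (I -> int) -> seq G) f :
  (forall n, definable_map (fun e => nth 1 (F e) n)) ->
  presburger (fun e => gholds (F e) f).
Proof.
elim: f I F => [u v||f IH|f IHf g IHg|f IHf g IHg|f IHf g IHg|i f IH|i f IH] I F FD /=.
- by apply: definable_map_eq; apply: geval_definable.
- exact: presburger_false.
- exact/presburger_not/IH.
- by apply: presburger_and; [apply: IHf|apply: IHg].
- by apply: presburger_or; [apply: IHf|apply: IHg].
- by apply: presburger_imp; [apply: IHf|apply: IHg].
- apply: (eq_presburger (P := fun e => ~ exists g, ~ gholds (set_nth 1 (F e) i g) f)).
    move=> e; split=> [nex g|all_g [g]]; last exact.
    by apply: contrapT => ng; apply: nex; exists g.
  apply/presburger_not/presburger_ex_group => t; apply/presburger_not/IH.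
  exact: definable_set_nth.
- by apply: presburger_ex_group => t; apply: IH; apply: definable_set_nth.
Qed.

Lemma definable_presburger (I : finType) q (V : set {ffun 'I_q -> G})
    (F : (I -> int) -> {ffun 'I_q -> G}) :
  definable V -> (forall i, definable_map (fun e => F e i)) -> presburger (fun e => V (F e)).
Proof.
move=> [f [m ->]] FD; apply: gholds_definable => n.
have [nq|qn] := ltnP n q; last first.
  apply: eq_definable_map (definable_map_const I (nth 1 m (n - q))) => e.
  by rewrite nth_cat size_map size_enum_ord ltnNge qn.
apply: eq_definable_map (FD (Ordinal nq)) => e.
rewrite nth_cat size_map size_enum_ord nq (nth_map (Ordinal nq)) ?size_enum_ord //.
by congr (F e _); apply/val_inj; rewrite /= nth_enum_ord.
Qed.

Lemma algebraic_presburger (I : finType) q (V : set {ffun 'I_q -> G})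
    (F : (I -> int) -> {ffun 'I_q -> G}) :
  algebraic V -> (forall i, definable_map (fun e => F e i)) -> presburger (fun e => V (F e)).
Proof.
move=> [m [E ->]] FD; apply: presburger_forall_fin => j.
by apply: definable_map_eq; apply: geval_definable => -[i|c];
  [exact: FD|exact: definable_map_const|exact: FD|exact: definable_map_const].
Qed.

Lemma conjugate_presburger (I : finType) (F F' : (I -> int) -> G) :
  definable_map F -> definable_map F' ->
  presburger (fun e => exists g, F e ^ g = F' e).
Proof.
move=> FD FD'; apply: presburger_ex_group => t.
have gD : definable_map (fun e : I + 'I_k -> int => emb (fun j => e (inr j)) * rep t).
  exact/affine_definable/affine_group_inr.
apply: definable_map_eq; last exact: definable_map_inl.
apply: definable_mapM; first exact: definable_mapV.
by apply: definable_mapM => //; apply: definable_map_inl.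
Qed.

End Interpretation.

Section SettingCoordinates.
Variables (G : groupType) (D : setting G).

Lemma left_coset_rep (g : G) : [set g * h | h in lattice D] g.
Proof. by exists 1; [apply: subgroup1; apply: lattice_subgroup|rewrite mulg1]. Qed.

Lemma left_coset_eq (g h : G) : lattice D (g^-1 * h) ->
  [set g * z | z in lattice D] = [set h * z | z in lattice D].
Proof.
have sD := lattice_subgroup D.
move=> gh; apply/seteqP; split=> _ [z zD <-].
  exists (h^-1 * g * z); last by rewrite !mulgA mulgV mul1g.
  by apply: subgroupM => //; rewrite -[h^-1 * g]invgK invgM invgK; apply: subgroupV.
by exists (g^-1 * h * z); [apply: subgroupM|rewrite !mulgA mulgV mul1g].
Qed.

Lemma setting_coords :
  exists C : coords G (lattice_rank D) (lattice_index D), range (emb C) = lattice D.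
Proof.
have [f [f_inj fD fZ]] := lattice_free D; have sD := lattice_subgroup D.
pose e (v : 'I_(lattice_rank D) -> int) : G := f (\row_i v i)%R.
have e_inj : injective e.
  move=> v w /f_inj /rowP vw; apply/funext => i.
  by have := vw i; rewrite !mxE.
have eD : {morph e : v w / (v + w)%R >-> v * w}.
  by move=> v w; rewrite /e -fD; congr f; apply/rowP => i; rewrite !mxE.
have e0 : e 0%R = 1 by apply: (mulgI (e 0%R)); rewrite -eD addr0 mulg1.
have eZ : range e = lattice D.
  rewrite -fZ; apply/seteqP; split=> _ [v _ <-]; first by exists (\row_i v i)%R.
  by exists (fun i => v ord0 i) => //; congr f; apply/rowP => i; rewrite mxE.
have e_norm g v : exists w, g * e v = e w * g.
  have : lattice D (e v ^ g^-1).
    by apply: lattice_normal; rewrite -eZ; exists v.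
  by rewrite -eZ => -[w _ wE]; exists w; rewrite wE conjgE invgK mulgA mulgVK.
have /card_set_bijP[phi [phi_fun phi_inj phi_surj]] := lattice_indexP D.
pose coset (g : G) : set G := [set g * h | h in lattice D].
have coset_in g : left_cosets (lattice D) (coset g) by exists g.
have /choice[r rE] (t : 'I_(lattice_index D)) : exists g, phi (coset g) = t.
  by have [|_ [g _ <-] <-] := phi_surj t; [exact: ltn_ord|exists g].
(* The coset gives g as a representative times a lattice element; normality moves the latter to the
   left. *)
have r_cover g : exists t v, g = e v * r t.
  have phi_lt : (phi (coset g) < lattice_index D)%N by apply: phi_fun.
  have cg : coset (r (Ordinal phi_lt)) = coset g.
    by apply: phi_inj; rewrite ?inE // rE.
  have [z] : coset (r (Ordinal phi_lt)) g by rewrite cg; apply: left_coset_rep.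
  rewrite -eZ => -[v _ <-] <-; exists (Ordinal phi_lt).
  by have [w ->] := e_norm (r (Ordinal phi_lt)) v; exists w.
have r_uniq s t v w : e v * r s = e w * r t -> s = t.
  move=> vw; apply/val_inj; rewrite /= -!rE; congr phi; apply: left_coset_eq.
  have -> : r t = e (- w + v)%R * r s.
    by rewrite eD -mulgA vw mulgA -eD addNr e0 mul1g.
  by apply: lattice_normal; rewrite -eZ; exists (- w + v)%R.
exists (Coords e_inj eD e_norm r_cover r_uniq).
by [].
Qed.

End SettingCoordinates.

(** * Patterned words *)

Lemma value_nil (G : groupType) (A : {fset G}) : value ([::] : seq A) = 1.
Proof. exact: big_nil. Qed.

Lemma value_cons (G : groupType) (A : {fset G}) (a : A) w : value (a :: w) = val a * value w.
Proof. exact: big_cons. Qed.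

Lemma value_cat (G : groupType) (A : {fset G}) (u w : seq A) :
  value (u ++ w) = value u * value w.
Proof. exact: big_cat. Qed.

Lemma value_rcons (G : groupType) (A : {fset G}) (a : A) w :
  value (rcons w a) = value w * val a.
Proof. by rewrite -cats1 value_cat value_cons value_nil mulg1. Qed.

Lemma value_nseq (G : groupType) (A : {fset G}) (a : A) n : value (nseq n a) = val a ^+ n.
Proof. by rewrite /value big_nseq iter_mulg_1. Qed.

Section Weight.
Variables (T : Type) (wt : T -> nat).

Lemma weight_nil : weight wt [::] = 0%N.
Proof. exact: big_nil. Qed.

Lemma weight_cons a w : weight wt (a :: w) = (wt a + weight wt w)%N.
Proof. exact: big_cons. Qed.

Lemma weight_cat u w : weight wt (u ++ w) = (weight wt u + weight wt w)%N.
Proof. exact: big_cat. Qed.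

Lemma weight_rcons a w : weight wt (rcons w a) = (weight wt w + wt a)%N.
Proof. by rewrite -cats1 weight_cat weight_cons weight_nil addn0. Qed.

Lemma weight_nseq a n : weight wt (nseq n a) = (n * wt a)%N.
Proof. by rewrite /weight big_nseq iter_addn_0 mulnC. Qed.

End Weight.

Lemma first_occurrence (T : eqType) (y : T) (s1 s2 t1 t2 : seq T) :
  y \notin s1 -> y \notin s2 -> s1 ++ y :: t1 = s2 ++ y :: t2 -> s1 = s2 /\ t1 = t2.
Proof.
elim: s1 s2 => [|a s1 IHs] [|b s2] //=.
- by move=> _ _ [].
- by rewrite inE negb_or => _ /andP[/eqP yb _] [/yb].
- by rewrite inE negb_or => /andP[/eqP ya _] _ [/esym/ya].
rewrite !inE !negb_or => /andP[_ y1] /andP[_ y2] [-> eqs].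
by have [-> ->] := IHs s2 y1 y2 eqs.
Qed.

Definition power_word (T : Type) (v : seq nat) (xs : seq T) : seq T :=
  flatten [seq nseq p.1 p.2 | p <- zip v xs].

Lemma power_word_sub (T : eqType) v (xs : seq T) : {subset power_word v xs <= xs}.
Proof.
rewrite /power_word; elim: xs v => [|x xs IHxs] [|n v] //= a.
by rewrite mem_cat => /orP[/nseqP[-> _]|/IHxs axs]; rewrite inE ?eqxx // axs orbT.
Qed.

(** The exponents are the numbers of occurrences of the letters. *)
Lemma power_word_inj (T : eqType) (xs : seq T) v v' : uniq xs ->
  size v = size xs -> size v' = size xs -> power_word v xs = power_word v' xs -> v = v'.
Proof.
move=> xs_uniq vx v'x /(congr1 (fun w => [seq count_mem x w | x <- xs])).
have count_pw u : size u = size xs -> [seq count_mem x (power_word u xs) | x <- xs] = u.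
  rewrite /power_word {vx v'x}; elim: xs u xs_uniq => [|x xs IHxs] [|n u] //=.
  move=> /andP[xNxs xs_uniq] [ux]; rewrite count_cat count_nseq /= eqxx mul1n.
  congr (_ :: _).
    rewrite (count_memPn _) ?addn0 //; apply: contra xNxs; exact: power_word_sub.
  rewrite -[RHS](IHxs u) //; apply/eq_in_map => z zxs.
  rewrite count_cat count_nseq /=; case: eqP => // xz.
  by rewrite xz zxs in xNxs.
by rewrite !count_pw.
Qed.

Lemma power_word0 (T : Type) n (xs : seq T) : power_word (nseq n 0%N) xs = [::].
Proof. by elim: n xs => [|n IHn] [|x xs] //=; apply: IHn. Qed.

Lemma incr_nth_cat (u v : seq nat) j :
  (j < size u)%N -> incr_nth (u ++ v) j = incr_nth u j ++ v.
Proof. by elim: u j => // n u IHu [|j] //= ju; rewrite IHu. Qed.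

Section PatternedWords.
Variables (G : groupType) (D : setting G).
Local Notation letters := (letters D).
Local Notation xs := (lattice_letters D).
Local Notation r := (size xs).
Implicit Types (pi : seq letters) (v : seq nat).

(** [patterned_word] without its constraint on the number of exponents, for inductions on the
    pattern. *)
Definition pattern_word pi v := flatten (patterned_tuple pi v).

Lemma pattern_word_nil v : pattern_word [::] v = power_word (take r v) xs.
Proof. by []. Qed.

Lemma pattern_word_cons y pi v :
  pattern_word (y :: pi) v = power_word (take r v) xs ++ y :: pattern_word pi (drop r v).
Proof. by rewrite /pattern_word /= flatten_cat. Qed.

Definition pattern_of (w : seq letters) := [seq s <- w | s \notin xs].

Lemma patterns_notin pi : patterns pi -> {in pi, forall y, y \notin xs}.
Proof. by move=> [_ piY] y /piY yY; apply/negP => /lattice_lettersP. Qed.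

Lemma pattern_of_pattern_word pi v :
  {in pi, forall y, y \notin xs} -> pattern_of (pattern_word pi v) = pi.
Proof.
have pw0 u : pattern_of (power_word u xs) = [::].
  by apply/eqP; rewrite -size_eq0 size_filter -leqn0 leqNgt -has_count;
     apply/hasPn => a /power_word_sub ->.
elim: pi v => [|y pi IHpi] v piY; first exact: pw0.
rewrite pattern_word_cons /pattern_of filter_cat -!/(pattern_of _) pw0 /=.
rewrite piY ?mem_head // -/(pattern_of _) IHpi // => z zpi.
by rewrite piY // inE zpi orbT.
Qed.

(** The first pattern letter cannot occur inside the first block, so its first occurrence marks
    where that block ends. *)
Lemma pattern_word_inj pi v v' : {in pi, forall y, y \notin xs} ->
  size v = pdim pi -> size v' = pdim pi ->
  pattern_word pi v = pattern_word pi v' -> v = v'.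
Proof.
rewrite /pdim; elim: pi v v' => [|y pi IHpi] v v' piY /=.
  rewrite mul0n add0n => vr v'r; rewrite !pattern_word_nil !take_oversize ?vr ?v'r //.
  by apply: power_word_inj => //; apply: lattice_letters_uniq.
rewrite !pattern_word_cons mulSn -addnA => vr v'r.
have yxs u : y \notin power_word u xs.
  by apply: contra (piY _ (mem_head _ _)); apply: power_word_sub.
have rle u : size u = (r + (size pi * r + r))%N -> size (take r u) = r.
  by move=> ur; rewrite size_takel // ur leq_addr.
move=> /(first_occurrence (yxs _) (yxs _))[/power_word_inj eqt /IHpi eqd].
rewrite -(cat_take_drop r v) -(cat_take_drop r v') eqt ?rle ?lattice_letters_uniq //.
rewrite eqd // ?size_drop ?vr ?v'r ?addKn // => z zpi.
by apply: piY; rewrite inE zpi orbT.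
Qed.

Lemma patterned_wordE pi (v : (pdim pi).-tuple nat) : patterned_word v = pattern_word pi v.
Proof. by []. Qed.

Lemma lattice_comm (x y : G) : lattice D x -> lattice D y -> x * y = y * x.
Proof.
have [f [_ fD <-]] := lattice_free D.
by move=> [u _ <-] [v _ <-]; rewrite -!fD addrC.
Qed.

Lemma lattice_word (w : seq letters) : {subset w <= xs} -> lattice D (value w).
Proof.
have sD := lattice_subgroup D.
elim: w => [|a w IHw] wx; first by rewrite value_nil; apply: subgroup1.
rewrite value_cons; apply: subgroupM => //.
  by apply/lattice_lettersP/wx/mem_head.
by apply: IHw => b bw; apply: wx; rewrite inE bw orbT.
Qed.

Lemma power_word_incr v (ls : seq letters) a : {subset ls <= xs} -> a \in ls ->
  size v = size ls ->
  value (power_word (incr_nth v (index a ls)) ls) = val a * value (power_word v ls) /\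
  weight (@letter_wt G D) (power_word (incr_nth v (index a ls)) ls) =
    (letter_wt a + weight (@letter_wt G D) (power_word v ls))%N.
Proof.
elim: ls v => [|x ls IHls] [|n v] //= lsx; rewrite inE eq_sym.
have [->|ax /= als [vls]] := eqVneq x a.
  by rewrite /power_word /= !weight_cons !value_cons.
have lsx' : {subset ls <= xs} by move=> b bls; apply: lsx; rewrite inE bls orbT.
have [valE wtE] := IHls v lsx' als vls.
rewrite /power_word /= -!/(power_word _ _) !value_cat !weight_cat valE wtE; split; last by rewrite addnCA.
rewrite !mulgA; congr (_ * _); apply: lattice_comm.
  by apply: lattice_word => b /nseqP[-> _]; apply: lsx; apply: mem_head.
by apply/lattice_lettersP/lsx'.
Qed.

Lemma pattern_word_incr pi v a : a \in xs -> (r <= size v)%N ->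
  value (pattern_word pi (incr_nth v (index a xs))) = val a * value (pattern_word pi v) /\
  weight (@letter_wt G D) (pattern_word pi (incr_nth v (index a xs))) =
    (letter_wt a + weight (@letter_wt G D) (pattern_word pi v))%N.
Proof.
move=> axs rv; have := size_takel rv; rewrite -[v in incr_nth v](cat_take_drop r).
move: (take r v) (drop r v) (cat_take_drop r v) => t d <- tr.
have ja : (index a xs < size t)%N by rewrite tr index_mem.
have itr : size (incr_nth t (index a xs)) = r by rewrite size_incr_nth ja.
have [valE wtE] := power_word_incr (fun=> id) axs tr.
rewrite incr_nth_cat //; case: pi => [|y pi].
  by rewrite !pattern_word_nil !take_size_cat.
rewrite !pattern_word_cons !take_size_cat ?drop_size_cat // !value_cat !weight_cat valE wtE.
by rewrite mulgA addnA.
Qed.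

(* Letters of X inside a block commute, so any word can be put in patterned form
   without changing its pattern, its value and its weight. *)
Lemma normalize_word (w : seq letters) : exists v,
  [/\ size v = pdim (pattern_of w), value (pattern_word (pattern_of w) v) = value w
    & weight (@letter_wt G D) (pattern_word (pattern_of w) v) =
      weight (@letter_wt G D) w].
Proof.
elim: w => [|a w [v [vr vv vw]]].
  exists (nseq r 0%N); rewrite size_nseq /pdim /= mul0n add0n pattern_word_nil.
  by rewrite take_nseq // power_word0.
rewrite /= value_cons weight_cons; case: ifPn => axs.
  exists (nseq r 0%N ++ v); split.
  - by rewrite size_cat size_nseq vr /pdim /= mulSn addnA.
  - rewrite pattern_word_cons take_size_cat ?drop_size_cat ?size_nseq // power_word0.
    by rewrite value_cons vv.
  - rewrite pattern_word_cons take_size_cat ?drop_size_cat ?size_nseq // power_word0.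
    by rewrite weight_cons vw.
rewrite negbK in axs; have rv : (r <= size v)%N by rewrite vr leq_addl.
have [valE wtE] := pattern_word_incr (pattern_of w) axs rv.
exists (incr_nth v (index a xs)); rewrite valE wtE vv vw size_incr_nth vr; split=> //.
by rewrite ifT // -vr (leq_trans _ rv) // index_mem.
Qed.

Lemma letter_of_word (u : seq (gens D)) : (0 < size u <= lattice_index D)%N ->
  exists2 y : letters, val y = value u & (letter_wt y <= weight (@gen_wt G D) u)%N.
Proof.
move=> ud; have yS : value u \in ball (gens D) (lattice_index D).
  by apply/ballP; exists u.
exists [` yS]%fset => //; rewrite /letter_wt /ball_wt; case: ex_minnP => m _; apply.
by apply/asboolP; exists u.
Qed.

Lemma word_of_letter (y : letters) : exists u : seq (gens D),
  expresses (lattice_index D) u (val y) /\ weight (@gen_wt G D) u = letter_wt y.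
Proof.
rewrite /letter_wt /ball_wt; case: ex_minnP => m /asboolP[u uy um] _.
by exists u.
Qed.

Lemma coset_index : exists kappa : G -> 'I_(lattice_index D),
  forall g h, kappa g = kappa h <-> lattice D (g^-1 * h).
Proof.
have [C CZ] := setting_coords D.
have /choice[t tE] := emb_cover C; exists t => g h.
have [v gE] := tE g; have [w hE] := tE h; split=> [gh|].
  rewrite {1}gE hE gh; set s := rep C _.
  rewrite invgM -mulgA (mulgA _ (emb C w)) -embN -embD.
  by apply: lattice_normal; rewrite -CZ; exists (- v + w)%R.
rewrite -CZ => -[u _ uE]; have [u' u'E] := emb_norm C g u.
apply: (@rep_uniq _ _ _ C _ _ (u' + v)%R w).
by rewrite -hE embD -mulgA -gE -u'E uE mulVKg.
Qed.

(** * Patterns of length at most the index *)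

Section PatternLength.
Variable kappa : G -> 'I_(lattice_index D).
Hypothesis kappaP : forall g h, kappa g = kappa h <-> lattice D (g^-1 * h).

Lemma kappa_mulr g h a : kappa g = kappa h -> kappa (g * a) = kappa (h * a).
Proof.
rewrite !kappaP invgM => /(lattice_normal a).
by rewrite conjgE !mulgA.
Qed.

(** Normality makes right multiplication well defined on cosets, so a lattice factor may stand
    anywhere. *)
Lemma kappa_insert g z h : lattice D z -> kappa (g * z * h) = kappa (g * h).
Proof.
move=> zD; apply: kappa_mulr; apply/esym/kappaP.
by rewrite mulKg.
Qed.

Definition visits (s : seq letters) : {set 'I_(lattice_index D)} :=
  [set t | `[< exists s1 s2, s = s1 ++ s2 /\ kappa (value s1) = t >]]%SET.

Lemma visitsP s t : reflect (exists s1 s2, s = s1 ++ s2 /\ kappa (value s1) = t) (t \in visits s).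
Proof. by rewrite !inE; apply: asboolP. Qed.

Definition pending (s : seq letters) (p : seq (gens D)) :=
  [seq kappa (value s * value (take i p)) | i <- iota 0 (size p).+1].

Lemma pending_rcons s p a :
  pending s (rcons p a) = rcons (pending s p) (kappa (value s * value p * val a)).
Proof.
rewrite /pending size_rcons -[in LHS]addn1 iotaD map_cat cats1; congr rcons.
  apply/eq_in_map => i; rewrite mem_iota add0n ltnS => ip.
  by rewrite -cats1 takel_cat.
by rewrite add0n take_oversize ?size_rcons // value_rcons mulgA.
Qed.

Lemma mem_pending s p t : t \in pending s p ->
  exists p1 p2, p = p1 ++ p2 /\ kappa (value s * value p1) = t.
Proof.
by move=> /mapP[i _ ->]; exists (take i p), (drop i p); rewrite cat_take_drop.
Qed.

Lemma pending_cat s p1 p2 : exists q, pending s (p1 ++ p2) = pending s p1 ++ q.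
Proof.
rewrite /pending size_cat -addSn iotaD map_cat; eexists; congr (_ ++ _).
apply/eq_in_map => i; rewrite mem_iota add0n ltnS => ip.
by rewrite takel_cat.
Qed.

(* [p] is the part of the input read since the last letter of Y was output; its
   prefixes lead to distinct cosets, all of which [s] visits. *)
Definition reduction (w p : seq (gens D)) (s : seq letters) :=
  [/\ value s * value p = value w,
      (weight (@letter_wt G D) s + weight (@gen_wt G D) p <= weight (@gen_wt G D) w)%N,
      (size (pattern_of s) < #|visits s|)%N,
      uniq (pending s p) & {subset pending s p <= visits s}].

(** The coset of s itself counts too, so p gives size p + 1 distinct cosets. The strict bound leaves
    room for one more generator when p becomes a letter. *)
Lemma size_pending s p : uniq (pending s p) -> (size p < lattice_index D)%N.
Proof.
move=> /card_uniqP pE; have := max_card (mem (pending s p)).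
by rewrite pE card_ord size_map size_iota.
Qed.

Lemma visits_nil : kappa 1 \in visits [::].
Proof. by apply/visitsP; exists [::], [::]; rewrite value_nil. Qed.

Lemma visits_end s : kappa (value s) \in visits s.
Proof. by apply/visitsP; exists s, [::]; rewrite cats0. Qed.

Lemma visits_insert s1 (z : letters) s2 : lattice D (val z) ->
  {subset visits (s1 ++ s2) <= visits (s1 ++ z :: s2)}.
Proof.
move=> zD t /visitsP[q1 [q2 [qE <-]]]; apply/visitsP.
have [le_q|lt_q] := leqP (size q1) (size s1).
  exists q1, (drop (size q1) s1 ++ z :: s2); split=> //.
  have -> : q1 = take (size q1) s1 by rewrite -(takel_cat s2 le_q) qE take_size_cat.
  by rewrite size_takel // catA cat_take_drop.
pose q := drop (size s1) q1.
have q1E : q1 = s1 ++ q.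
  have s1E : s1 = take (size s1) q1.
    by rewrite -(takel_cat q2 (ltnW lt_q)) -qE take_size_cat.
  by rewrite /q {1}s1E cat_take_drop.
have s2E : s2 = q ++ q2.
  by have := congr1 (drop (size s1)) qE; rewrite q1E -catA !drop_size_cat.
exists (s1 ++ z :: q), q2; rewrite s2E -catA; split=> //.
by rewrite q1E !value_cat value_cons mulgA kappa_insert.
Qed.

(** The letter y adds at most one to the pattern, and the coset it reaches is newly visited. *)
Lemma reduction_output w p s (y : letters) t :
  reduction w p s -> kappa (value s * val y) = t -> t \notin visits s ->
  (size (pattern_of (rcons s y)) < #|visits (rcons s y)|)%N.
Proof.
move=> [_ _ sV _ _] yt tV; apply: (@leq_trans #|t |: visits s|%SET).
  rewrite cardsU1 tV /pattern_of filter_rcons.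
  by case: ifP => _; rewrite ?size_rcons add1n ltnS // ltnW.
apply/subset_leq_card/fintype.subsetP => u; rewrite in_setU1 => /predU1P[->|].
  by rewrite -yt -value_rcons visits_end.
move=> /visitsP[s1 [s2 [-> <-]]]; apply/visitsP.
by exists s1, (rcons s2 y); rewrite rcons_cat.
Qed.

Lemma reduction_step w p s a : reduction w p s ->
  exists p' s', reduction (rcons w a) p' s'.
Proof.
move=> red; have [sp wt_sp sV p_uniq pV] := red.
have pd := size_pending p_uniq.
set t := kappa (value s * value p * val a).
(* At a coset new to the output, the segment together with a is output as one letter. *)
have [tV|tV] := boolP (t \in visits s); last first.
  have [|y yE y_wt] := @letter_of_word (rcons p a); first by rewrite size_rcons.
  have yt : kappa (value s * val y) = t by rewrite yE value_rcons mulgA.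
  exists [::], (rcons s y); split.
  - by rewrite value_nil mulg1 !value_rcons yE value_rcons mulgA sp.
  - rewrite weight_nil addn0 !weight_rcons; rewrite weight_rcons in y_wt; lia.
  - exact: reduction_output red yt tV.
  - by [].
  - move=> u; rewrite /pending /= inE => /eqP->.
    by rewrite value_nil mulg1 visits_end.
(* At a visited coset that the segment has not met, the segment just grows. *)
have [/mem_pending[p1 [p2 [pE p1t]]]|tp] := boolP (t \in pending s p); last first.
  exists (rcons p a), s; split; rewrite ?value_rcons ?weight_rcons ?pending_rcons //.
  - by rewrite mulgA sp.
  - by rewrite addnA leq_add2r.
  - by rewrite rcons_uniq tp.
  - by move=> u; rewrite mem_rcons inE => /predU1P[->|/pV].
(* The segment has closed a loop, and p2 followed by a is a lattice element z. As p1 is not output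
   yet, z goes to a cut s1, s2 of the output at the same coset; the value of s2 p1 lies in the
   lattice, so z commutes with it. *)
have [|z zE z_wt] := @letter_of_word (rcons p2 a).
  by rewrite size_rcons /= (leq_ltn_trans _ pd) // pE size_cat leq_addl.
have zD : lattice D (val z).
  have : kappa (value s * value p1) = kappa (value s * value p1 * val z).
    by rewrite p1t zE value_rcons mulgA -[_ * value p2]mulgA -value_cat -pE.
  by rewrite kappaP mulKg.
have /visitsP[s1 [s2 [sE s1t]]] := tV.
have s12 : value s = value s1 * value s2 by rewrite sE value_cat.
have s2D : lattice D (value s2 * value p1).
  by move: s1t; rewrite -p1t kappaP s12 -mulgA mulKg.
have s'E u : kappa (value (s1 ++ z :: s2) * u) = kappa (value s * u).
  by rewrite value_cat value_cons s12 -!mulgA (mulgA (value s1)) kappa_insert.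
have pendE : pending (s1 ++ z :: s2) p1 = pending s p1.
  by apply: eq_map => i; apply: s'E.
exists p1, (s1 ++ z :: s2); split.
- rewrite value_cat value_cons !mulgA -(mulgA _ (value s2)) -(mulgA (value s1)).
  rewrite (lattice_comm zD s2D) zE !value_rcons -sp s12 pE value_cat !mulgA.
  by [].
- rewrite weight_rcons; rewrite weight_rcons in z_wt; move: wt_sp.
  rewrite sE pE !weight_cat weight_cons; lia.
- have zX : z \in xs by apply/lattice_lettersP.
  rewrite /pattern_of filter_cat /= zX /= -filter_cat -sE.
  apply: leq_trans sV (subset_leq_card _); apply/fintype.subsetP => u; rewrite sE.
  exact: visits_insert.
- rewrite pendE; move: p_uniq; rewrite pE; have [q ->] := pending_cat s p1 p2.
  by rewrite cat_uniq => /andP[].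
- move=> u; rewrite pendE => up; apply: visits_insert zD _ _; rewrite -sE; apply: pV.
  by have [q] := pending_cat s p1 p2; rewrite pE => ->; rewrite mem_cat up.
Qed.

Lemma reduction_exists w : exists p s, reduction w p s.
Proof.
elim/last_ind: w => [|w a [p [s /(@reduction_step w p s a)]]//].
exists [::], [::]; split; rewrite ?value_nil ?mulg1 ?weight_nil //.
- by apply/card_gt0P; exists (kappa 1); apply: visits_nil.
- by move=> u; rewrite /pending /= inE !value_nil mulg1 => /eqP->; apply: visits_nil.
Qed.

End PatternLength.

Lemma patterned_word_exists (w : seq (gens D)) : exists pi (v : (pdim pi).-tuple nat),
  [/\ patterns pi, value (patterned_word v) = value w
    & (weight (@letter_wt G D) (patterned_word v) <= weight (@gen_wt G D) w)%N].
Proof.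
have [kappa kappaP] := coset_index.
suff [s sw [s_wt sd]] : exists2 s : seq letters, value s = value w &
    (weight (@letter_wt G D) s <= weight (@gen_wt G D) w)%N /\
    (size (pattern_of s) <= lattice_index D)%N.
  have [v [vr vs v_wt]] := normalize_word s.
  exists (pattern_of s), (Tuple (introT eqP vr)); split.
  - by split=> // y; rewrite mem_filter => /andP[/negP yX _] /lattice_lettersP.
  - by rewrite -sw -vs.
  - by move: s_wt; rewrite -v_wt.
have [p [s [sp wt_sp sV p_uniq _]]] := reduction_exists kappaP w.
have Vd : (#|visits kappa s| <= lattice_index D)%N.
  by rewrite -[leqRHS]card_ord max_card.
case: p sp wt_sp p_uniq => [|a p] sp wt_sp p_uniq.
  exists s; first by rewrite -sp value_nil mulg1.
  rewrite weight_nil addn0 in wt_sp; split=> //.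
  exact: leq_trans (ltnW sV) Vd.
(* What is still pending becomes one last letter; the strict inequality between pattern length and
   visited cosets leaves room for it. *)
have [|y yE y_wt] := @letter_of_word (a :: p).
  by rewrite /= ltnW // (size_pending p_uniq).
exists (rcons s y); first by rewrite value_rcons yE.
split; first by rewrite weight_rcons (leq_trans _ wt_sp) // leq_add2l.
rewrite /pattern_of filter_rcons; case: ifP => _; rewrite ?size_rcons.
  exact: leq_trans sV Vd.
exact: leq_trans (ltnW sV) Vd.
Qed.

End PatternedWords.

(** * Geodesic systems *)

Section Exponents.
Variables (H : groupType) (D : setting H).
Local Notation xs := (lattice_letters D).
Implicit Types pi : seq (letters D).

Definition exponents pi (e : 'I_(pdim pi) -> int) : (pdim pi).-tuple nat :=
  [tuple `|e i|%N | i < pdim pi].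

Definition word_at pi (e : 'I_(pdim pi) -> int) : seq (letters D) :=
  patterned_word (exponents e).

Lemma word_atE pi (e : 'I_(pdim pi) -> int) :
  word_at e = pattern_word pi [seq `|e i|%N | i <- enum 'I_(pdim pi)].
Proof. by []. Qed.

Section Values.
Variables (G : groupType) (k d : nat) (C : coords G k d) (p : H -> G).
Hypothesis pM : {morph p : x y / x * y}.
Variable I : finType.

(** The exponents are read from an arbitrary list of variables, so that an induction on the pattern
    can drop those of a finished block. *)
Lemma value_power_word_definable (js : seq I) (ls : seq (letters D)) :
  definable_map C (fun e => p (value (power_word [seq `|e j|%N | j <- js] ls))).
Proof.
have p1 : p 1 = 1 by apply: (mulgI (p 1)); rewrite -pM !mulg1.
have pX x n : p (x ^+ n) = p x ^+ n.
  by elim: n => [|n IHn]; rewrite ?expg0 // !expgS pM IHn.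
elim: ls js => [|x ls IHls] [|j js]; try by
  apply: eq_definable_map (definable_map_const C I (p 1)) => e; rewrite /value big_nil.
apply: eq_definable_map (definable_mapM
  (definable_map_expg C (p (val x)) (affine_var j)) (IHls js)) => e.
by rewrite -pX -pM /power_word /= value_cat value_nseq.
Qed.

Lemma value_pattern_word_definable pi (js : seq I) :
  definable_map C (fun e => p (value (pattern_word pi [seq `|e j|%N | j <- js]))).
Proof.
elim: pi js => [|y pi IHpi] js.
  apply: eq_definable_map (value_power_word_definable (take (size xs) js) xs) => e.
  by rewrite pattern_word_nil map_take.
apply: eq_definable_map (definable_mapM (value_power_word_definable (take (size xs) js) xs)
  (definable_mapM (definable_map_const C I (p (val y))) (IHpi (drop (size xs) js)))) => e.
by rewrite pattern_word_cons value_cat value_cons !pM map_take map_drop.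
Qed.

End Values.

Lemma value_word_at_definable (G : groupType) (k d : nat) (C : coords G k d) (p : H -> G) pi :
  {morph p : x y / x * y} ->
  definable_map C (fun e : 'I_(pdim pi) -> int => p (value (word_at e))).
Proof.
by move=> pM; apply: eq_definable_map (value_pattern_word_definable C pM pi (enum 'I_(pdim pi))).
Qed.

(** Weights are computed from absolute values of the exponents, so affinity can be expected only
    here. *)
Definition affine_on_nonneg (I : finType) (f : (I -> int) -> nat) :=
  exists2 g, affine g & forall e, nonneg e -> (f e)%:Z = g e.

Lemma weight_power_word_affine (I : finType) (js : seq I) (ls : seq (letters D)) :
  affine_on_nonneg (fun e =>
    weight (@letter_wt H D) (power_word [seq `|e j|%N | j <- js] ls)).
Proof.
elim: ls js => [|x ls IHls] [|j js]; try by
  exists (fun=> 0%R); [exact: affine_const|move=> e _; rewrite /= weight_nil].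
have [g gA gE] := IHls js; exists (fun e => e j * (letter_wt x)%:Z + g e)%R.
  by apply: affineD => //; apply: affineZr; apply: affine_var.
move=> e e_ge0; rewrite /power_word /= weight_cat weight_nseq PoszD PoszM gez0_abs //.
by congr (_ + _)%R; apply: gE.
Qed.

Lemma weight_pattern_word_affine (I : finType) pi (js : seq I) :
  affine_on_nonneg (fun e =>
    weight (@letter_wt H D) (pattern_word pi [seq `|e j|%N | j <- js])).
Proof.
elim: pi js => [|y pi IHpi] js.
  have [g gA gE] := weight_power_word_affine (take (size xs) js) xs.
  by exists g => // e e_ge0; rewrite pattern_word_nil -map_take gE.
have [g gA gE] := weight_power_word_affine (take (size xs) js) xs.
have [h hA hE] := IHpi (drop (size xs) js).
exists (fun e => g e + ((letter_wt y)%:Z + h e))%R.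
  by do !apply: affineD => //; apply: affine_const.
move=> e e_ge0; rewrite pattern_word_cons weight_cat weight_cons -map_take -map_drop.
by rewrite !PoszD gE // hE.
Qed.

Definition pattern_list : seq (seq (letters D)) :=
  [seq pi <- flatten [seq [seq tval t | t <- enum {: j.-tuple (letters D)}]
                     | j <- iota 0 (lattice_index D).+1] | `[< patterns pi >]].

Lemma mem_pattern_list pi : pi \in pattern_list <-> patterns pi.
Proof.
rewrite mem_filter; split=> [/andP[/asboolP]//|piP].
apply/andP; split; first exact/asboolP.
apply/flatten_mapP; exists (size pi); first by rewrite mem_iota ltnS; case: piP.
by apply/mapP; exists (in_tuple pi); rewrite ?mem_enum.
Qed.

End Exponents.

Section Selection.
Variables (G : groupType) (D : setting G).
Variable C : coords G (lattice_rank D) (lattice_index D).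
Variable R : G -> G -> Prop.
Hypothesis R_refl : forall g, R g g.
Hypothesis R_sym : forall g h, R g h -> R h g.
Hypothesis R_trans : forall g h f, R g h -> R h f -> R g f.
Hypothesis R_definable : forall (I : finType) (F F' : (I -> int) -> G),
  definable_map C F -> definable_map C F' -> presburger (fun e => R (F e) (F' e)).
Local Notation r := (size (lattice_letters D)).

(* Pairs of a pattern and an exponent vector. *)
Definition family := forall pi : seq (letters D), ('I_(pdim pi) -> int) -> Prop.

Definition key := forall pi : seq (letters D), ('I_(pdim pi) -> int) -> nat.

Implicit Types (Q : family) (f : key).

Definition refine f Q : family := fun pi e => Q pi e /\
  forall pi', pi' \in pattern_list D -> forall e', Q pi' e' ->
  R (value (word_at e)) (value (word_at e')) -> (f pi e <= f pi' e')%N.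

Definition presburger_family Q :=
  (forall pi, presburger (Q pi)) /\ forall pi e, Q pi e -> nonneg e.

Definition affine_key f := forall pi, affine_on_nonneg (f pi).

(** All members are nonnegative, so the keys may be replaced by affine maps; the quantifier over
    patterns is a finite conjunction. *)
Lemma refine_presburger f Q :
  affine_key f -> presburger_family Q -> presburger_family (refine f Q).
Proof.
move=> fA [Qp Q_ge0]; split=> [pi|pi e []]; last by move/Q_ge0.
have [g gA gE] := fA pi.
have valD (pi' : seq (letters D)) :
    definable_map C (fun e : 'I_(pdim pi') -> int => value (word_at e)).
  exact: (value_word_at_definable C (p := id)).
have [g' g'P] : {g' : forall pi', ('I_(pdim pi') -> int) -> int | forall pi',
    affine (g' pi') /\ forall e, nonneg e -> (f pi' e)%:Z = g' pi' e}.
  exists (fun pi' => s2val (cid2 (fA pi'))) => pi'.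
  by split; [exact: (s2valP (cid2 (fA pi')))|exact: (s2valP' (cid2 (fA pi')))].
apply: (eq_presburger (P := fun e => Q pi e /\ all (fun pi' => `[< forall e', Q pi' e' ->
    R (value (word_at e)) (value (word_at e')) -> (g e <= g' pi' e')%R >]) (pattern_list D))).
  move=> e; split=> -[Qe min_e]; split=> //.
    move=> pi' pi'P e' Qe' Ree'; have /asboolP/(_ e' Qe' Ree') := allP min_e pi' pi'P.
    by rewrite -lez_nat gE ?(g'P pi').2 //; [apply: Q_ge0 Qe'|apply: Q_ge0 Qe].
  apply/allP => pi' pi'P; apply/asboolP => e' Qe' Ree'.
  have := min_e pi' pi'P e' Qe' Ree'.
  by rewrite -lez_nat gE ?(g'P pi').2 //; [apply: Q_ge0 Qe'|apply: Q_ge0 Qe].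
apply: presburger_and => //; apply: presburger_all => pi'.
apply: (presburger_forall (P := fun e' e => Q pi' e' ->
    R (value (word_at e)) (value (word_at e')) -> (g e <= g' pi' e')%R)).
apply: presburger_imp.
  by apply: (presburger_comp (h := fun i e => e (inr i)) (Qp pi')) => i; apply: affine_var.
apply: presburger_imp.
  apply: R_definable.
    refine (@definable_map_comp _ _ _ C _ _ (fun e => value (word_at e))
      (fun i e => e (inl i)) (valD pi) _) => i; exact: affine_var.
  refine (@definable_map_comp _ _ _ C _ _ (fun e => value (word_at e))
    (fun i e => e (inr i)) (valD pi') _) => i; exact: affine_var.
apply: presburger_le; last apply: (affine_comp (h := fun i e => e (inr i)) (g'P pi').1) => i.
  by apply: (affine_comp (h := fun i e => e (inl i)) gA) => i; apply: affine_var.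
exact: affine_var.
Qed.

Fixpoint survivors (fs : seq key) Q : family :=
  if fs is f :: fs' then survivors fs' (refine f Q) else Q.

Lemma refine_exists f Q g :
  (exists pi (e : 'I_(pdim pi) -> int),
    [/\ pi \in pattern_list D, Q pi e & R g (value (word_at e))]) ->
  exists pi (e : 'I_(pdim pi) -> int),
    [/\ pi \in pattern_list D, refine f Q e & R g (value (word_at e))].
Proof.
move=> [pi0 [e0 [pi0P Q0 R0]]].
have exn : exists n, `[< exists pi (e : 'I_(pdim pi) -> int),
    [/\ pi \in pattern_list D, Q pi e,
    R g (value (word_at e)) & f pi e = n] >].
  by exists (f _ e0); apply/asboolP; exists pi0, e0.
case: (ex_minnP exn) => n /asboolP[pi [e [piP Qe Re fe]]] nmin.
exists pi, e; split=> //; split=> // pi' pi'P e' Qe' Ree'.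
rewrite fe; apply: nmin; apply/asboolP; exists pi', e'; split=> //.
exact: R_trans Re Ree'.
Qed.

Lemma survivors_exists fs Q g :
  (exists pi (e : 'I_(pdim pi) -> int),
    [/\ pi \in pattern_list D, Q pi e & R g (value (word_at e))]) ->
  exists pi (e : 'I_(pdim pi) -> int),
    [/\ pi \in pattern_list D, survivors fs Q e & R g (value (word_at e))].
Proof. by elim: fs Q => //= f fs IHfs Q Qg; apply: IHfs; apply: refine_exists. Qed.

Lemma survivors_sub fs Q pi (e : 'I_(pdim pi) -> int) : survivors fs Q e -> Q pi e.
Proof. by elim: fs Q => //= f fs IHfs Q /IHfs[]. Qed.

Lemma survivors_presburger fs Q :
  (forall j, affine_key (nth (fun _ _ => 0%N) fs j)) -> presburger_family Q ->
  presburger_family (survivors fs Q).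
Proof.
elim: fs Q => //= f fs IHfs Q fsA Qp; apply: IHfs => [j|]; first exact: (fsA j.+1).
by apply: refine_presburger => //; apply: (fsA 0%N).
Qed.

(** Each refinement makes one key constant on the members of a class, and later ones only remove
    members. *)
Lemma survivors_key fs Q pi pi' (e : 'I_(pdim pi) -> int) (e' : 'I_(pdim pi') -> int) j :
  pi \in pattern_list D -> pi' \in pattern_list D ->
  survivors fs Q e -> survivors fs Q e' ->
  R (value (word_at e)) (value (word_at e')) ->
  nth (fun _ _ => 0%N) fs j pi e = nth (fun _ _ => 0%N) fs j pi' e'.
Proof.
move=> piP pi'P; elim: fs Q j => [|f fs IHfs] Q [|j] //= eS e'S ee'; last exact: IHfs eS e'S ee'.
have [Qe emin] := survivors_sub eS; have [Qe' e'min] := survivors_sub e'S.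
by apply/eqP; rewrite eqn_leq emin // e'min //; apply: R_sym.
Qed.

Definition weight_key : key := fun pi e => weight (@letter_wt G D) (word_at e).
Definition index_key : key := fun pi e => index pi (pattern_list D).
(** Coordinates beyond the dimension of the pattern read as 0, so one list of keys serves all
    patterns. *)
Definition coord_key j : key := fun pi e => nth 0%N (exponents e) j.

(* Minimizing these keys one after the other singles out one word in each class. *)
Definition keys : seq key := [:: weight_key, index_key &
  [seq coord_key j | j <- iota 0 (lattice_index D * r + r)]].

Definition candidates : family := fun pi e => nonneg e.

Definition selected : family := survivors keys candidates.

Lemma selected_presburger : presburger_family selected.
Proof.
apply: survivors_presburger => [j pi|]; last first.
  split=> // pi; apply: presburger_forall_fin => i.
  by apply: presburger_le; [apply: affine_const|apply: affine_var].
have key0 n : affine_on_nonneg (fun=> n : nat).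
  by exists (fun=> n%:Z) => //; apply: affine_const.
case: j => [|[|j]] /=; first exact: weight_pattern_word_affine.
  exact: key0.
have [jN|Nj] := ltnP j (lattice_index D * r + r); last first.
  by rewrite nth_default ?size_map ?size_iota.
rewrite (nth_map 0%N) ?size_iota // nth_iota // /coord_key add0n.
have [jd|dj] := ltnP j (pdim pi); last first.
  exists (fun=> 0%R); first exact: affine_const.
  by move=> e _; rewrite nth_default ?size_tuple.
exists (fun e => e (Ordinal jd)); first exact: affine_var.
move=> e e_ge0; rewrite -[j]/(nat_of_ord (Ordinal jd)) -tnth_nth tnth_mktuple.
exact: gez0_abs.
Qed.

Lemma selected_unique pi pi' (e : 'I_(pdim pi) -> int) (e' : 'I_(pdim pi') -> int) :
  patterns pi -> patterns pi' -> selected e -> selected e' ->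
  R (value (word_at e)) (value (word_at e')) -> word_at e = word_at e'.
Proof.
move=> piP pi'P eS e'S ee'.
have keyE j := survivors_key j ((mem_pattern_list _).2 piP) ((mem_pattern_list _).2 pi'P) eS e'S ee'.
have pipi' : pi = pi'.
  have := keyE 1%N; rewrite /= /index_key => idx.
  by rewrite -[pi](nth_index pi ((mem_pattern_list _).2 piP)) idx nth_index //; apply/mem_pattern_list.
subst pi'; rewrite /word_at; congr patterned_word; apply: eq_from_tnth => i.
have iN : (i < lattice_index D * r + r)%N.
  apply: leq_trans (ltn_ord i) _; rewrite leq_add2r leq_mul2r.
  by case: piP => -> _; rewrite orbT.
have := keyE i.+2; rewrite /= (nth_map 0%N) ?size_iota // nth_iota // /coord_key add0n.
by rewrite -!tnth_nth.
Qed.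

(** Words over S compete here, but the reduction reads generators: each letter is first expanded, at
    unchanged weight. *)
Lemma patterned_word_below (w : seq (letters D)) : exists pi (e : 'I_(pdim pi) -> int),
  [/\ patterns pi, nonneg e, value (word_at e) = value w
    & (weight_key e <= weight (@letter_wt G D) w)%N].
Proof.
have [u uw u_wt] : exists2 u : seq (gens D), value u = value w &
    weight (@gen_wt G D) u = weight (@letter_wt G D) w.
  elim: w => [|y w [u uw u_wt]]; first by exists [::]; rewrite ?value_nil ?weight_nil.
  have [uy [[_ uyE] uy_wt]] := word_of_letter y.
  by exists (uy ++ u); rewrite ?value_cat ?weight_cat ?uyE ?uy_wt ?uw ?u_wt ?value_cons ?weight_cons.
have [pi [v [piP vu v_wt]]] := patterned_word_exists u.
exists pi, (fun i => (tnth v i)%:Z); rewrite /weight_key /word_at.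
have -> : exponents (fun i => (tnth v i)%:Z) = v.
  by apply: eq_from_tnth => i; rewrite tnth_mktuple.
by rewrite vu uw -u_wt.
Qed.

Lemma geodesic_system_exists (classes : set (set G)) :
  (forall c, classes c -> exists g, forall h, c h <-> R g h) ->
  exists U, polyhedral_geodesic_system (D := D) classes U.
Proof.
move=> classesR.
pose U pi : set (seq (letters D)) :=
  [set w | exists2 e : 'I_(pdim pi) -> int, selected e & w = word_at e].
exists U; split=> [pi _ _ [e _ ->]|c /classesR[g cE]|pi piP].
- by exists (exponents e).
- have [pi0 [e0 [pi0P e0_ge0 e0g]]] : exists pi (e : 'I_(pdim pi) -> int),
      [/\ pi \in pattern_list D, candidates e & R g (value (word_at e))].
    have [w0 gw0] := gens_generate D g.
    have [pi [v [piP vg _]]] := patterned_word_exists w0.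
    exists pi, (fun i => (tnth v i)%:Z); split=> //; first exact/mem_pattern_list.
    rewrite /word_at (_ : exponents _ = v); first by rewrite vg gw0.
    by apply: eq_from_tnth => i; rewrite tnth_mktuple.
  have [pi [e [/mem_pattern_list piP eS ge]]] : exists pi (e : 'I_(pdim pi) -> int),
      [/\ pi \in pattern_list D, selected e & R g (value (word_at e))].
    by apply: survivors_exists; exists pi0, e0.
  split.
    exists (word_at e); split; first by split; [exists pi => //; exists e|apply/cE].
    move=> w [[pi' pi'P [e' e'S ->]] /cE ge'].
    by apply: selected_unique => //; apply: R_trans (R_sym ge) ge'.
  move=> _ [pi' pi'P [e' e'S ->]] /cE ge' w' /cE gw'.
  have [pi1 [e1 [pi1P e1_ge0 e1w' e1_wt]]] := patterned_word_below w'.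
  (* The weight is the first key, so it is minimized over all candidates of the class. *)
  have /survivors_sub[[_ e'min] _] : survivors (behead (behead keys)) (refine index_key
    (refine weight_key candidates)) e' := e'S.
  have w'g : R (value (word_at e')) (value (word_at e1)).
    by apply: R_trans (R_sym ge') _; rewrite e1w'.
  by apply: leq_trans (e'min pi1 _ e1 e1_ge0 w'g) e1_wt; apply/mem_pattern_list.
(* A patterned word determines its exponents, so the image under phi is the set of selected vectors
   itself. *)
- suff -> : @phi_image _ D pi (U pi) =
      [set z | selected (fun i : 'I_(pdim pi) => z ord0 i)].
    exact/presburger_polyhedral/(selected_presburger.1 pi).
  apply/seteqP; split=> z /=.
    move=> [v [e eS /pattern_word_inj vE] <-].
    have -> // : (fun i => (\row_i (tnth v i)%:Z)%R ord0 i) = e.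
    have -> : v = exponents e.
      by apply/val_inj/vE; rewrite ?size_tuple //; apply: patterns_notin.
    apply/funext => i; rewrite mxE tnth_mktuple gez0_abs //.
    exact: (selected_presburger.2 _ _ eS).
  move=> zS; exists (exponents (fun i => z ord0 i)); first by exists (fun i => z ord0 i).
  apply/rowP => i; rewrite mxE tnth_mktuple gez0_abs //.
  exact: (selected_presburger.2 _ _ zS).
Qed.

End Selection.

Close Scope ring_scope.
Close Scope group_scope.

(** * Automata *)

Section LinearAutomaton.
Variables (n : nat) (A : finType).
Local Notation B := ('I_n * A)%type.
Implicit Types (b : B) (u : seq B) (i : 'I_n).

(** A letter (i, a) writes a on the i-th coordinate, so words over [B] spell tuples. *)
Definition coord_letter i b : option A := if b.1 == i then Some b.2 else None.

Definition coord_word i u : seq A := pmap (coord_letter i) u.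

Lemma coord_word_cat i u w : coord_word i (u ++ w) = coord_word i u ++ coord_word i w.
Proof. exact: pmap_cat. Qed.

Lemma coord_word_flatten i (us : seq (seq B)) :
  coord_word i (flatten us) = flatten [seq coord_word i u | u <- us].
Proof. by elim: us => //= u us IHus; rewrite coord_word_cat IHus. Qed.

Definition linear_language (L : seq (seq B * seq (seq B))) : set (n.-tuple (seq A)) :=
  [set t | exists2 l, l \in L & exists2 us, {subset us <= l.2} &
    forall i, tnth t i = coord_word i (l.1 ++ flatten us)].

Variable L : seq (seq B * seq (seq B)).

(* In state [(us, u)], the word [u] is to be output, then words of [us]. *)
Definition positions : seq (seq (seq B) * seq B) :=
  flatten [seq [seq (l.2, drop j u) | u <- l.1 :: l.2, j <- iota 0 (size u).+1] | l <- L].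

Definition linear_state : finType := option (seq_sub positions).

Definition label_of (b : B) : n.-tuple (option A) := [tuple coord_letter i b | i < n].

Definition no_label : n.-tuple (option A) := nseq_tuple n None.

(** From the start None, a pair of [L] is guessed and its constant word is output; whenever the
    current word is spent, a period is guessed. *)
Definition linear_edge (e : linear_state * n.-tuple (option A) * linear_state) : bool :=
  let: (q, lab, q') := e in
  match q, q' with
  | None, Some x => (lab == no_label) && has (fun l => ssval x == (l.2, l.1)) L
  | Some x, Some y =>
    if (ssval x).2 is b :: u then (lab == label_of b) && (ssval y == ((ssval x).1, u))
    else [&& lab == no_label, (ssval y).1 == (ssval x).1 & (ssval y).2 \in (ssval x).1]
  | _, None => false
  end.

Lemma linear_edgeP e : e \in [set e | linear_edge e]%SET ->
  (#|[pred i | tnth e.1.2 i != None]| <= 1)%N.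
Proof.
have no i : tnth no_label i = None by rewrite (tnth_nth None) nth_nseq ltn_ord.
have eps : (#|[pred i | tnth no_label i != None]| <= 1)%N.
  by rewrite eq_card0 // => i; rewrite inE no.
rewrite inE; case: e => [[[x|] lab] [y|]] //=; last by case/andP => /eqP->.
case: (ssval x).2 => [|b u]; first by case/andP => /eqP->.
case/andP => /eqP-> _; rewrite -(card1 b.1); apply/subset_leq_card/fintype.subsetP => i.
by rewrite !inE tnth_mktuple /coord_letter [b.1 == i]eq_sym; case: ifP.
Qed.

Definition linear_automaton : async_automaton n A :=
  @AsyncAutomaton n A linear_state None
    [set q | if q is Some x then (ssval x).2 == [::] else false]%SET
    [set e | linear_edge e]%SET linear_edgeP.

Lemma linear_path_word (x : seq_sub positions) p :
  @aa_path _ _ linear_automaton (Some x) p ->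
  exists2 us, {subset us <= (ssval x).1} & forall i,
    pmap (fun e => tnth e.1 i) p = coord_word i ((ssval x).2 ++ flatten us).
Proof.
elim: p x => [|[lab [y|]] p IHp] x /=.
- by rewrite inE => /eqP xE; exists [::] => // i; rewrite xE.
- rewrite inE => /andP[/= xy /IHp[us usP pE]].
  case xE: (ssval x).2 xy => [|b u].
    case/and3P => /eqP-> /eqP y1 y2; exists ((ssval y).2 :: us).
      by move=> w; rewrite inE => /predU1P[->//|/usP]; rewrite y1.
    by move=> i; rewrite (tnth_nth None) nth_nseq ltn_ord /= pE.
  case/andP => /eqP-> /eqP yE; exists us; first by move: usP; rewrite yE.
  by move=> i; rewrite tnth_mktuple pE yE /coord_word /=.
- by rewrite inE.
Qed.

Lemma mem_positions l u j : l \in L -> u \in l.1 :: l.2 -> (l.2, drop j u) \in positions.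
Proof.
move=> lL ul; apply/flatten_mapP; exists l => //; apply/allpairsPdep.
have [ju|uj] := leqP j (size u).
  by exists u, j; rewrite mem_iota ltnS.
by exists u, (size u); rewrite mem_iota ltnS leqnn drop_size drop_oversize // ltnW.
Qed.

(** Spells the rest of u, then follows a given path from the state in which u is spent. *)
Lemma linear_path_drop l u j (x z : seq_sub positions) p0 :
  l \in L -> u \in l.1 :: l.2 -> ssval x = (l.2, drop j u) -> ssval z = (l.2, [::]) ->
  @aa_path _ _ linear_automaton (Some z) p0 ->
  exists2 p, @aa_path _ _ linear_automaton (Some x) p & forall i,
    pmap (fun e => tnth e.1 i) p = coord_word i (drop j u) ++ pmap (fun e => tnth e.1 i) p0.
Proof.
move=> lL ul xE zE p0P.
elim: {j}(size u - j)%N {-2}j (erefl (size u - j)%N) x xE => [|m IHm] j mE x xE.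
  have u0 : drop j u = [::] by apply: drop_oversize; rewrite -subn_eq0 mE.
  have <- : z = x by apply: val_inj; rewrite /= xE zE u0.
  by exists p0; rewrite // u0.
have y_pos := mem_positions j.+1 lL ul.
have [|p pP pE] := IHm j.+1 _ (SeqSub y_pos) erefl; first by rewrite subnS mE.
have dropS : drop j.+1 u = behead (drop j u) by rewrite -drop1 drop_drop.
case dE: (drop j u) => [|b w].
  by move: (congr1 size dE); rewrite size_drop mE.
exists ((label_of b, Some (SeqSub y_pos)) :: p) => /= [|i].
  by rewrite inE /= pP andbT xE dE /= dropS dE /= !eqxx.
by rewrite tnth_mktuple pE dropS dE /= /coord_word /=; case: coord_letter.
Qed.

Lemma linear_word_path l u us : l \in L -> u \in l.1 :: l.2 -> {subset us <= l.2} ->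
  forall x : seq_sub positions, ssval x = (l.2, u) ->
  exists2 p, @aa_path _ _ linear_automaton (Some x) p &
    forall i, pmap (fun e => tnth e.1 i) p = coord_word i (u ++ flatten us).
Proof.
move=> lL; elim: us u => [|v us IHus] u ul usl x xE.
  have z_pos := mem_positions (size u) lL ul; rewrite drop_size in z_pos.
  have [|||||p pP pE] := @linear_path_drop l u 0 x (SeqSub z_pos) [::] => //.
  - by rewrite drop0.
  - by rewrite /= inE.
  by exists p => // i; rewrite pE drop0 coord_word_cat.
have vl : v \in l.1 :: l.2 by rewrite inE usl ?mem_head ?orbT.
have z_pos := mem_positions (size u) lL ul; rewrite drop_size in z_pos.
have y_pos := mem_positions 0 lL vl; rewrite drop0 in y_pos.
have [w wus|p pP pE] := IHus v vl _ (SeqSub y_pos) erefl.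
  by apply: usl; rewrite inE wus orbT.
have [|||||p' p'P p'E] := @linear_path_drop l u 0 x (SeqSub z_pos)
  ((no_label, Some (SeqSub y_pos)) :: p) => //.
- by rewrite drop0.
- by rewrite /= inE /= !eqxx pP usl ?mem_head.
exists p' => // i; rewrite p'E drop0 /= (tnth_nth None) nth_nseq ltn_ord pE.
by rewrite !coord_word_cat.
Qed.

Lemma linear_language_regular : n_regular (linear_language L).
Proof.
exists linear_automaton; apply/seteqP; split=> t.
  move=> [l lL [us usl tE]].
  have x_pos : (l.2, l.1) \in positions.
    by have := mem_positions 0 lL (mem_head l.1 l.2); rewrite drop0.
  have [p pP pE] := @linear_word_path l l.1 us lL (mem_head _ _) usl (SeqSub x_pos) erefl.
  exists ((no_label, Some (SeqSub x_pos)) :: p) => /=.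
    rewrite pP andbT inE /= eqxx /=; apply/hasP; by exists l.
  by move=> i; rewrite tE (tnth_nth None no_label) nth_nseq ltn_ord pE.
move=> [[|[lab [x|]] p]] /=; rewrite ?inE //= => /andP[/andP[/eqP-> /hasP[l lL /eqP xE]]].
move=> /linear_path_word[us usl pE] tE; exists l => //; rewrite xE /= in usl pE.
by exists us => // i; rewrite tE (tnth_nth None) nth_nseq ltn_ord pE.
Qed.

End LinearAutomaton.

(** * From automata on tuples to EDT0L languages *)

Lemma endo_app_cat (C : finType) (f : free_endo C) u w :
  endo_app f (u ++ w) = endo_app f u ++ endo_app f w.
Proof. by rewrite /endo_app map_cat flatten_cat. Qed.

Lemma endo_app_flatten (C : finType) (f : free_endo C) (us : seq (seq C)) :
  endo_app f (flatten us) = flatten [seq endo_app f u | u <- us].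
Proof. by elim: us => //= u us IHus; rewrite endo_app_cat IHus. Qed.

(* The nonterminal [inr i] stands at the left of the part of the i-th coordinate
   that is already produced; the labels of a path are applied from the last one to
   the first one, and the nonterminals are finally erased. *)
Section RegularEDT0L.
Variables (n : nat) (A A' : finType) (sub : A -> seq A') (M : async_automaton n A).
Local Notation C := (A' + 'I_n)%type.

Definition label_endo (x : option (n.-tuple (option A))) : free_endo C :=
  [ffun c => match c, x with
    | inl a, _ => [:: inl a]
    | inr i, None => [::]
    | inr i, Some lab => inr i :: oapp (fun a => map inl (sub a)) [::] (tnth lab i)
    end].

Definition endos : {fset free_endo C} :=
  [fset label_endo x | x in {: option (n.-tuple (option A))}]%fset.

Lemma label_endo_in x : label_endo x \in endos.
Proof. exact: in_imfset. Qed.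

Definition endo_of x : endos := [` label_endo_in x]%fset.

(** [M] is nondeterministic and distinct labels may induce the same endomorphism, hence sets of
    states. The start None reads the erasing endomorphism, since the head of a word is applied
    last. *)
Definition subset_step (Q : option {set aa_state M}) (b : endos) : option {set aa_state M} :=
  if Q is Some Q then
    Some [set q' | [exists q in Q, exists lab,
      (label_endo (Some lab) == val b) && ((q, lab, q') \in aa_edges M)]]%SET
  else Some [set q | (val b == label_endo None) && (q == aa_start M)]%SET.

Definition subset_dfa : dfa endos :=
  @Dfa endos (option {set aa_state M}) None
    [set X : option {set aa_state M} |
      if X is Some Q then ~~ [disjoint Q & aa_accept M] else false]%SET subset_step.

Lemma subset_dfaP (Q : {set aa_state M}) (h : seq endos) :
  foldl subset_step (Some Q) h \in dfa_accept subset_dfa <->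
  exists q p, [/\ q \in Q, aa_path q p &
    [seq val b | b <- h] = [seq label_endo (Some e.1) | e <- p]].
Proof.
elim: h Q => [|b h IHh] Q /=.
  rewrite inE -setI_eq0; split=> [/set0Pn[q /setIP[qQ qM]]|[q [[|e p] [qQ qM]]]] //.
    by exists q, [::].
  by move=> _; apply/set0Pn; exists q; apply/setIP.
rewrite IHh; split=> [[q' [p [q'Q q'p ->]]]|[q [[|[lab q'] p] [qQ /=]]]] //; last first.
  move=> /andP[qq' q'p] [bE ->]; exists q', p; split=> //.
  rewrite inE; apply/exists_inP; exists q => //.
  by apply/existsP; exists lab; rewrite bE eqxx.
move: q'Q; rewrite inE => /exists_inP[q qQ /existsP[lab /andP[/eqP labE qq']]].
by exists q, ((lab, q') :: p); rewrite /= qq' q'p labE.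
Qed.

Definition nonterminals : seq C := [seq inr i | i <- enum 'I_n].

Lemma endo_app_inl x (w : seq A') : endo_app (label_endo x) (map inl w) = map inl w.
Proof. by elim: w => //= a w IHw; rewrite /endo_app /= ffunE -/(endo_app _ _) IHw. Qed.

Lemma foldr_labels (p : seq (n.-tuple (option A) * aa_state M)) :
  foldr (fun e u => endo_app (label_endo (Some e.1)) u) nonterminals p =
  flatten [seq inr i :: map inl (flatten (map sub (pmap (fun e => tnth e.1 i) p)))
          | i <- enum 'I_n].
Proof.
elim: p => [|[lab q] p IHp] /=.
  by rewrite /nonterminals; elim: (enum 'I_n) => //= i s ->.
rewrite IHp endo_app_flatten -map_comp; congr flatten; apply: eq_map => i /=.
rewrite -cat1s endo_app_cat endo_app_inl /endo_app /= ffunE cats0.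
by case: (tnth lab i) => [a|] //=; rewrite -map_cat.
Qed.

Lemma endo_app_erase (F : 'I_n -> seq A') :
  endo_app (label_endo None) (flatten [seq inr i :: map inl (F i) | i <- enum 'I_n]) =
  map inl (flatten [seq F i | i <- enum 'I_n]).
Proof.
elim: (enum 'I_n) => //= i s IHs.
by rewrite -cat1s endo_app_cat endo_app_cat IHs endo_app_inl /endo_app /= ffunE map_cat.
Qed.

(** The substitution serves both alphabets: single letters for S, expansions for the generators. *)
Lemma aa_lang_EDT0L : EDT0L [set flatten (map sub (flatten t)) | t in aa_lang M].
Proof.
exists C, inl, nonterminals, endos, subset_dfa; split; first by move=> a b [].
have flattenE (t : n.-tuple (seq A)) : flatten (map sub (flatten t)) =
    flatten [seq flatten (map sub (tnth t i)) | i <- enum 'I_n].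
  rewrite -[in LHS](map_tnth_enum t); elim: (enum 'I_n) => //= i s <-.
  by rewrite map_cat flatten_cat.
apply/seteqP; split=> w.
  move=> [t [p pM tE] <-]; exists (endo_of None :: [seq endo_of (Some e.1) | e <- p]).
    rewrite /dfa_lang /=; apply/subset_dfaP; exists (aa_start M), p; split=> //.
      by rewrite inE !eqxx.
    by rewrite -map_comp; apply: eq_map.
  rewrite /= foldr_map foldr_labels endo_app_erase flattenE.
  by congr map; congr flatten; apply: eq_map => i; rewrite tE.
move=> [h]; rewrite /dfa_lang /=; case: h => [|b h] /=; first by rewrite inE.
move=> /subset_dfaP[q [p [qM pM hE]]] wE.
move: qM; rewrite inE => /andP[/eqP bE /eqP qE].
exists [tuple pmap (fun e => tnth e.1 i) p | i < n].
  by exists p => [|i]; rewrite ?tnth_mktuple // -qE.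
apply: (inj_map (f := inl : A' -> C)); first by move=> a b' [].
rewrite wE bE (_ : foldr _ _ h =
    foldr (fun e u => endo_app (label_endo (Some e.1)) u) nonterminals p).
  rewrite foldr_labels endo_app_erase flattenE; congr map; congr flatten.
  by apply: eq_map => i; rewrite tnth_mktuple.
by elim: h p hE {bE wE qE pM} => [|c h IHh] [|e p] //= [-> /IHh ->].
Qed.

End RegularEDT0L.

Local Open Scope ring_scope.
Local Open Scope group_scope.

(** * Languages of patterned words *)

Section PatternedLanguages.
Variables (H : groupType) (D : setting H).
Local Notation letters := (letters D).
Local Notation xs := (lattice_letters D).
Local Notation r := (size xs).
Implicit Types pi : seq letters.

Definition blocks (I : Type) (e : I -> int) (js : seq I) (ls : seq letters) : seq (seq letters) :=
  [seq nseq p.1 p.2 | p <- zip [seq `|e j|%N | j <- js] ls].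

(* The tuple of [pi] and the exponents [e], without the letters of [pi]. *)
Fixpoint power_tuple pi (v : seq nat) : seq (seq letters) :=
  let block := [seq nseq p.1 p.2 | p <- zip (take r v) xs] in
  if pi is y :: pi' then block ++ [::] :: power_tuple pi' (drop r v) else block.

Lemma nth_blockD (I : finType) (e f : I -> int) js (ls : seq letters) i :
  nonneg e -> nonneg f ->
  nth [::] (blocks (e + f)%R js ls) i = nth [::] (blocks e js ls) i ++ nth [::] (blocks f js ls) i.
Proof.
move=> e_ge0 f_ge0; rewrite /blocks; elim: js ls i => [|j js IHjs] [|x ls] [|i] //=.
by rewrite -nseqD; congr nseq; have := e_ge0 j; have := f_ge0 j; rewrite fctE; lia.
Qed.

Lemma size_blocks (I : Type) (e : I -> int) js (ls : seq letters) :
  size (blocks e js ls) = minn (size js) (size ls).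
Proof. by rewrite size_map size_zip size_map. Qed.

(** Pattern letters must appear once in a sum: they stay with e, and [power_tuple] leaves their
    coordinates empty. *)
Lemma nth_patterned_tupleD (I : finType) (e f : I -> int) pi js i :
  nonneg e -> nonneg f ->
  nth [::] (patterned_tuple pi [seq `|(e + f)%R j|%N | j <- js]) i =
  nth [::] (patterned_tuple pi [seq `|e j|%N | j <- js]) i ++
  nth [::] (power_tuple pi [seq `|f j|%N | j <- js]) i.
Proof.
move=> e_ge0 f_ge0; elim: pi js i => [|y pi IHpi] js i /=.
  by rewrite -!map_take; apply: nth_blockD.
rewrite -!map_take -!map_drop -!/(blocks _ _ _) !nth_cat !size_blocks.
case: ifP => _; first exact: nth_blockD.
by case: (i - _)%N => //= i'; apply: IHpi.
Qed.

Lemma size_patterned_tuple pi v : size v = pdim pi ->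
  size (patterned_tuple pi v) = (pdim pi + size pi)%N.
Proof.
rewrite /pdim; elim: pi v => [|y pi IHpi] v /= vr.
  by rewrite size_map size_zip size_takel ?vr // minnn mul0n addn0.
rewrite size_cat size_map size_zip /= size_takel ?vr ?leq_addl // minnn.
rewrite IHpi; first by rewrite mulSn addnS addnS !addnA.
by rewrite size_drop vr mulSn -addnA addKn.
Qed.

Lemma patterned_tuple_dim n pi : patterns pi ->
  (lattice_index D * r + r + lattice_index D <= n)%N -> (pdim pi + size pi <= n)%N.
Proof.
move=> [pid _]; apply: leq_trans.
by rewrite leq_add // /pdim leq_add2r leq_mul2r pid orbT.
Qed.

Section Regular.
Variable n : nat.
Hypothesis n_ge : forall pi, patterns pi -> (pdim pi + size pi <= n)%N.
Local Notation B := ('I_n * letters)%type.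

Definition tuple_word (ws : seq (seq letters)) : seq B :=
  flatten [seq [seq (i, a) | a <- nth [::] ws i] | i : 'I_n <- enum 'I_n].

Lemma coord_tuple_word i (ws : seq (seq letters)) :
  coord_word i (tuple_word ws) = nth [::] ws i.
Proof.
rewrite coord_word_flatten -map_comp.
have part (j : 'I_n) s : coord_word i [seq (j, a) | a <- s] = if j == i then s else [::].
  rewrite /coord_word; elim: s => [|a s IHs] /=; first by case: ifP.
  by rewrite IHs /coord_letter /=; case: ifP.
rewrite (eq_map (g := fun j : 'I_n => if j == i then nth [::] ws j else [::])); last first.
  by move=> j /=; rewrite part.
have := enum_uniq 'I_n; have : i \in enum 'I_n by rewrite mem_enum.
elim: (enum 'I_n) => //= j s IHs; rewrite inE => /predU1P[<-|js] /andP[jNs s_uniq].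
  rewrite eqxx -[RHS]cats0; congr (_ ++ _).
  elim: s jNs {IHs s_uniq} => //= k s IHs; rewrite inE negb_or => /andP[ik /IHs->].
  by rewrite eq_sym (negbTE ik).
rewrite IHs //; case: eqP => // ji; by rewrite ji js in jNs.
Qed.

(* Adding exponent vectors concatenates the tuples coordinatewise, so a linear set of
   exponent vectors spells a linear language. *)
Lemma psi_regular (L : set (seq letters)) :
  (forall pi, patterns pi -> presburger (fun e : 'I_(pdim pi) -> int =>
     nonneg e /\ L (word_at e))) ->
  n_regular (@psi H D n L).
Proof.
move=> Lp; pose E pi (e : 'I_(pdim pi) -> int) := [seq `|e i|%N | i <- enum 'I_(pdim pi)].
have /choice[K KP] pi : exists K : seq (seq B * seq (seq B)), patterns pi ->
    forall t : n.-tuple (seq letters), linear_language K t <->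
      exists e : 'I_(pdim pi) -> int, [/\ nonneg e, L (word_at e) &
        forall i, tnth t i = nth [::] (patterned_tuple pi (E pi e)) i].
  have [piP|npi] := pselect (patterns pi); last by exists [::].
  have [K K_ge0 KE] := nonneg_presburger_semilinear (Lp pi piP) (fun _ => @proj1 _ _).
  exists [seq (tuple_word (patterned_tuple pi (E pi l.1)),
               [seq tuple_word (power_tuple pi (E pi p)) | p <- l.2]) | l <- K] => _ t.
  have spell c ps i : nonneg c -> (forall p, p \in ps -> nonneg p) ->
      coord_word i (tuple_word (patterned_tuple pi (E pi c)) ++
        flatten [seq tuple_word (power_tuple pi (E pi p)) | p <- ps]) =
      nth [::] (patterned_tuple pi (E pi (c + \sum_(p <- ps) p)%R)) i.
    elim: ps c => [|p ps IHps] c c_ge0 ps_ge0.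
      by rewrite big_nil addr0 cats0 coord_tuple_word.
    have p_ge0 : nonneg p by apply: ps_ge0; rewrite mem_head.
    rewrite big_cons addrA -IHps => [||q qps]; last 2 first.
    - by move=> j; rewrite fctE addr_ge0.
    - by apply: ps_ge0; rewrite inE qps orbT.
    by rewrite /= !coord_word_cat !coord_tuple_word catA nth_patterned_tupleD.
  split.
    move=> [_ /mapP[l lK ->] [us usl tE]] /=.
    have [l_ge0 ps_ge0] := K_ge0 l lK.
    have [ps psl usE] : exists2 ps : seq ('I_(pdim pi) -> int), {subset ps <= l.2} &
        us = [seq tuple_word (power_tuple pi (E pi p)) | p <- ps].
      elim: us usl {tE} => [|u us IHus] usl; first by exists [::].
      have [|ps psl ->] := IHus; first by move=> w wus; apply: usl; rewrite inE wus orbT.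
      have /mapP[p pl ->] := usl u (mem_head _ _).
      by exists (p :: ps) => // q; rewrite inE => /predU1P[->|/psl].
    have ps_nonneg p : p \in ps -> nonneg p by move=> /psl/ps_ge0.
    have /(KE _).2[e_ge0 Le] : exists2 k, k \in K & linear_set k (l.1 + \sum_(p <- ps) p)%R.
      by exists l => //; exists (\sum_(p <- ps) p)%R => //; exists ps.
    exists (l.1 + \sum_(p <- ps) p)%R; split=> // i.
    by rewrite tE usE spell.
  move=> [e [e_ge0 Le tE]].
  have [l lK [_ [ps psl ->] eE]] := (KE e).1 (conj e_ge0 Le).
  have [l_ge0 ps_ge0] := K_ge0 l lK.
  exists (tuple_word (patterned_tuple pi (E pi l.1)),
          [seq tuple_word (power_tuple pi (E pi p)) | p <- l.2]); first exact: map_f.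
  exists [seq tuple_word (power_tuple pi (E pi p)) | p <- ps] => /=.
    by move=> _ /mapP[p /psl pl ->]; apply: map_f.
  by move=> i; rewrite tE eE spell // => p /psl/ps_ge0.
suff -> : @psi H D n L = linear_language (flatten [seq K pi | pi <- pattern_list D]).
  exact: linear_language_regular.
(* Padding by empty words agrees with the default value of [nth]. *)
have paddedP pi (v : (pdim pi).-tuple nat) (t : n.-tuple (seq letters)) : patterns pi ->
    tval t = patterned_tuple pi v ++ nseq (n - size (patterned_tuple pi v)) [::] <->
    forall i, tnth t i = nth [::] (patterned_tuple pi v) i.
  move=> /n_ge; rewrite -(size_patterned_tuple (size_tuple v)) => le_n.
  have nthE i : nth [::] (patterned_tuple pi v ++ nseq (n - size (patterned_tuple pi v)) [::]) i =
      nth [::] (patterned_tuple pi v) i.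
    by rewrite nth_cat nth_nseq if_same; case: ltnP => // /(nth_default _)->.
  split=> [tE i|tE]; first by rewrite (tnth_nth [::]) tE nthE.
  apply: (@eq_from_nth _ [::]); rewrite size_tuple.
    by rewrite size_cat size_nseq subnKC.
  by move=> i i_n; rewrite nthE -(tE (Ordinal i_n)) (tnth_nth [::]).
apply/seteqP; split=> t.
  move=> [pi [v [piP Lv /(paddedP _ _ _ piP) tE]]].
  have : linear_language (K pi) t.
    apply/KP => //; exists (fun i => (tnth v i)%:Z).
    have vE : exponents (fun i => (tnth v i)%:Z) = v.
      by apply: eq_from_tnth => i; rewrite tnth_mktuple.
    by split=> // [|i]; rewrite ?/word_at -?[E _ _]/(tval (exponents _)) vE.
  move=> [l lK lt]; exists l => //; apply/flatten_mapP; exists pi => //.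
  exact/mem_pattern_list.
move=> [l /flatten_mapP[pi /mem_pattern_list piP lK] lt].
have /(KP pi piP)[e [_ Le tE]] : linear_language (K pi) t by exists l.
by exists pi, (exponents e); split=> //; apply/paddedP.
Qed.

Lemma theta_psi (L : set (seq letters)) :
  (forall w, L w -> exists pi, patterns pi /\ patterned_words pi w) ->
  @theta H D n @` @psi H D n L = L.
Proof.
have thetaE pi (v : (pdim pi).-tuple nat) (t : n.-tuple (seq letters)) :
    tval t = patterned_tuple pi v ++ nseq (n - size (patterned_tuple pi v)) [::] ->
    theta t = patterned_word v.
  rewrite /theta => ->; rewrite flatten_cat (_ : flatten (nseq _ _) = [::]) ?cats0 //.
  by elim: (n - _)%N.
move=> LW; apply/seteqP; split=> [_ [t [pi [v [piP Lv /thetaE tE]]] <-]|w Lw].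
  by rewrite tE.
have [pi [piP [v _ vw]]] := LW w Lw.
have sz : size (patterned_tuple pi v ++ nseq (n - size (patterned_tuple pi v)) [::]) == n.
  rewrite size_cat size_nseq subnKC // size_patterned_tuple ?size_tuple //.
  exact: n_ge.
exists (Tuple sz); last by rewrite (thetaE pi v).
by exists pi, v; split=> //; rewrite vw.
Qed.

End Regular.

Lemma value_expand sigma (w : seq letters) : expansion sigma ->
  value (expand sigma w) = value w.
Proof.
move=> sigmaP; elim: w => [|s w IHw]; first by rewrite !value_nil.
by rewrite /expand /= value_cat value_cons -IHw; have [[_ ->] _] := sigmaP s.
Qed.

Lemma weight_expand sigma (w : seq letters) : expansion sigma ->
  weight (@gen_wt H D) (expand sigma w) = weight (@letter_wt H D) w.
Proof.
move=> sigmaP; elim: w => [|s w IHw]; first by rewrite !weight_nil.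
by rewrite /expand /= weight_cat weight_cons -IHw; have [_ ->] := sigmaP s.
Qed.

Variable n : nat.
Hypothesis n_ge : forall pi, patterns pi -> (pdim pi + size pi <= n)%N.

(** A word that is lightest in its class is lightest for its own element; [cover] supplies the
    class. *)
Lemma geodesic_language_of_presburger classes U (L : set (seq letters)) :
  (forall g, exists2 c, classes c & c g) ->
  polyhedral_geodesic_system classes U ->
  (forall w, L w -> GF U w) ->
  (forall pi, patterns pi -> presburger (fun e : 'I_(pdim pi) -> int =>
     nonneg e /\ L (word_at e))) ->
  geodesic_language n L.
Proof.
move=> cover [UW Umin Upol] LU Lp.
have theta_L : @theta H D n @` @psi H D n L = L.
  by apply: theta_psi => // w /LU[pi piP Uw]; exists pi; split=> //; apply: UW.
have reg := psi_regular n_ge Lp.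
have EDT0L_image (A' : finType) (sub : letters -> seq A') :
    EDT0L [set flatten (map sub w) | w in L].
  rewrite -theta_L image_comp; case: reg => M ->; exact: aa_lang_EDT0L.
split=> //.
- move=> t tL sigma sigmaP; split; first exact: value_expand.
  have Lt : L (theta t) by rewrite -theta_L; exists t.
  have [c cc ct] := cover (value (theta t)).
  (* A competitor over the generators is compared through a patterned word over S of at most its
     weight. *)
  move=> w' w'E; have [pi [v [_ vE v_wt]]] := patterned_word_exists w'.
  rewrite weight_expand //; apply: leq_trans v_wt.
  by apply: (Umin c cc).2; [apply: LU| |rewrite vE w'E].
- have := EDT0L_image _ (fun a => [:: a]).
  rewrite (_ : [set _ | _ in L] = L) //; apply/seteqP; split=> [_ [w Lw <-]|w Lw].
    by rewrite flatten_seq1.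
  by exists w; rewrite ?flatten_seq1.
- by move=> sigma _; apply: EDT0L_image.
Qed.

(* A word in [U pi'] with pattern [pi] forces [pi' = pi]. *)
Lemma GF_presburger classes U pi : polyhedral_geodesic_system classes U -> patterns pi ->
  presburger (fun e : 'I_(pdim pi) -> int => nonneg e /\ GF U (word_at e)).
Proof.
move=> [UW _ Upol] piP; have := polyhedral_presburger (Upol pi piP).
apply: eq_presburger => e; split=> [[v Uv vE]|[e_ge0 [pi' pi'P Ue]]].
  have eE i : e i = (tnth v i)%:Z by have /rowP/(_ i) := vE; rewrite !mxE.
  split=> [i|]; first by rewrite eE.
  exists pi => //; rewrite /word_at (_ : exponents e = v) //.
  by apply: eq_from_tnth => i; rewrite tnth_mktuple eE.
have [v' _ v'E] := UW pi' pi'P _ Ue.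
have pipi' : pi' = pi.
  move: (congr1 (@pattern_of H D) v'E); rewrite patterned_wordE word_atE.
  by rewrite !pattern_of_pattern_word //; apply: patterns_notin.
subst pi'; exists (exponents e) => //.
by apply/rowP => i; rewrite !mxE tnth_mktuple gez0_abs.
Qed.

End PatternedLanguages.

Lemma GF_of_presburger (H : groupType) (D : setting H) U (V : set H) pi :
  polyhedral_geodesic_system (D := D) (singletons H) U -> patterns pi ->
  presburger (fun e : 'I_(pdim pi) -> int => V (value (word_at e))) ->
  presburger (fun e : 'I_(pdim pi) -> int => nonneg e /\ GF_of U V (word_at e)).
Proof.
move=> US piP Vp.
apply: eq_presburger (presburger_and (GF_presburger US piP) Vp) => e.
by split=> [[[]]|[? []]].
Qed.

Lemma singletons_cover (H : groupType) (g : H) : exists2 c, singletons H c & c g.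
Proof. by exists [set g] => //; exists g. Qed.

Lemma left_cosets_cover (H : groupType) (K : set H) (g : H) :
  subgroup K -> exists2 c, left_cosets K c & c g.
Proof.
move=> Ks; exists [set g * h | h in K]; first by exists g.
by exists 1; [apply: subgroup1|rewrite mulg1].
Qed.

Lemma conjugacy_classes_cover (H : groupType) (g : H) :
  exists2 c, conjugacy_classes H c & c g.
Proof. by exists [set g ^ h | h in setT]; [exists g|exists 1; rewrite ?conjg1]. Qed.

(** The length of the tuple of a pattern of length d: (d + 1) r powers and d pattern letters. *)
Definition tuple_dim (H : groupType) (D : setting H) : nat :=
  (lattice_index D * size (lattice_letters D) + size (lattice_letters D) + lattice_index D)%N.

Lemma tuple_dimP (H : groupType) (D : setting H) (pi : seq (letters D)) :
  patterns pi -> (pdim pi + size pi <= tuple_dim D)%N.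
Proof. by move=> piP; apply: patterned_tuple_dim. Qed.

Close Scope group_scope.
Close Scope ring_scope.
Close Scope classical_set_scope.

Theorem theorem1p3 (G : groupType) (D : setting G) :
  [/\ exists U, polyhedral_geodesic_system (D := D) (singletons G) U,
      forall H : set G, subgroup H ->
        exists U, polyhedral_geodesic_system (D := D) (left_cosets H) U
    & exists U, polyhedral_geodesic_system (D := D) (conjugacy_classes G) U]
  /\
  (exists n : nat,
    (forall pi : seq (letters D), patterns pi -> pdim pi + size pi <= n) /\
    [/\ forall (U : seq (letters D) -> set (seq (letters D))) (V : set G),
          polyhedral_geodesic_system (singletons G) U ->
          [\/ rational V, subgroup V, algebraic (as_pow1 V)
            | definable (as_pow1 V)] ->
          geodesic_language n (GF_of U V),
        forall (H : set G) (U : seq (letters D) -> set (seq (letters D))), subgroup H ->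
          polyhedral_geodesic_system (left_cosets H) U ->
          geodesic_language n (GF U)
      & forall U : seq (letters D) -> set (seq (letters D)),
          polyhedral_geodesic_system (conjugacy_classes G) U ->
          geodesic_language n (GF U)])
  /\
  (forall (q : nat) (Dq : setting {ffun 'I_q -> G}), 0 < q ->
   exists n : nat,
    (forall pi : seq (letters Dq), patterns pi -> pdim pi + size pi <= n) /\
    forall (U : seq (letters Dq) -> set (seq (letters Dq))) (V : set {ffun 'I_q -> G}),
      polyhedral_geodesic_system (singletons {ffun 'I_q -> G}) U ->
      algebraic V \/ definable V ->
      geodesic_language n (GF_of U V)).
Proof.
have [C CZ] := setting_coords D.
have valD (pi : seq (letters D)) :
    definable_map C (fun e : 'I_(pdim pi) -> int => value (word_at e)).
  exact: (value_word_at_definable C (p := id)).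
split; last split.
- split.
  + apply: (geodesic_system_exists (C := C) (R := eq)) => //.
    * by move=> g h f ->.
    * by move=> I F F'; apply: definable_map_eq.
    * by move=> _ [g _ <-]; exists g => h; split=> /= ->.
  + move=> H Hs; apply: (geodesic_system_exists (C := C) (R := fun g h => H (g^-1 * h)%g)).
    * by move=> g; rewrite mulVg; apply: subgroup1.
    * by move=> g h gh; rewrite -[g in (_ * g)%g]invgK -invgM; apply: subgroupV.
    * move=> g h f gh hf; rewrite -[f](mulVKg h) mulgA; exact: subgroupM.
    * move=> I F F' FD FD'; apply: (definable_set_map (subgroup_definable C Hs)).
      by apply: definable_mapM => //; apply: definable_mapV.
    * move=> _ [g _ <-]; exists g => h; split=> [[z zH <-]|gh]; first by rewrite mulKg.
      by exists (g^-1 * h)%g; rewrite ?mulVKg.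
  + apply: (geodesic_system_exists (C := C) (R := fun g h => exists u, (g ^ u)%g = h)).
    * by move=> g; exists 1%g; rewrite conjg1.
    * by move=> g h [u <-]; exists (u^-1)%g; rewrite conjgK.
    * by move=> g h f [u <-] [v <-]; exists (u * v)%g; rewrite conjgM.
    * by move=> I F F'; apply: conjugate_presburger.
    * move=> _ [g _ <-]; exists g => h; split=> [[u _ <-]|[u <-]]; first by exists u.
      by exists u.
- exists (tuple_dim D); split; [exact: tuple_dimP|split].
  + move=> U V US VP; apply: (geodesic_language_of_presburger (@tuple_dimP _ D) (@singletons_cover G) US).
      by move=> w [].
    move=> pi piP; apply: GF_of_presburger US piP _.
    have asD i : definable_map C (fun e : 'I_(pdim pi) -> int =>
        ([ffun=> value (word_at e)] : {ffun 'I_1 -> G}) i).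
      by apply: eq_definable_map (valD pi) => e; rewrite ffunE.
    have as1 e : as_pow1 V [ffun=> value (word_at e)] <-> V (value (@word_at _ _ pi e)).
      by rewrite /as_pow1 /= ffunE.
    case: VP => [Vr|Vs|Va|Vd].
    * exact: definable_set_map (rational_definable C Vr) (valD pi).
    * exact: definable_set_map (subgroup_definable C Vs) (valD pi).
    * exact: eq_presburger as1 (algebraic_presburger Va asD).
    * exact: eq_presburger as1 (definable_presburger Vd asD).
  + move=> H U Hs US; apply: (geodesic_language_of_presburger (@tuple_dimP _ D) _ US) => //.
      by move=> g; apply: left_cosets_cover.
    by move=> pi; apply: GF_presburger US.
  + move=> U US; apply: (geodesic_language_of_presburger (@tuple_dimP _ D) _ US) => //.
      exact: conjugacy_classes_cover.
    by move=> pi; apply: GF_presburger US.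
move=> q Dq _; exists (tuple_dim Dq); split; first exact: tuple_dimP.
move=> U V US VP.
apply: (geodesic_language_of_presburger (@tuple_dimP _ Dq) (@singletons_cover _) US).
  by move=> w [].
move=> pi piP; apply: GF_of_presburger US piP _.
(* Taking the i-th coordinate is a homomorphism to G, so the coordinates [C] of G are used. *)
have coordD i : definable_map C (fun e : 'I_(pdim pi) -> int => value (word_at e) i).
  apply: (value_word_at_definable C (p := fun x : {ffun 'I_q -> G} => x i)) => x y.
  by rewrite ffunE.
by case: VP => [Va|Vd]; [apply: algebraic_presburger Va coordD|apply: definable_presburger Vd coordD].
Qed.
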